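(* Suppose that the reference measure $R\in\mathrm{M}_+(\Omega)$ is Markov, and let $\mu_0,\mu_1\in\mathrm{P}(\mathcal{X})$. If the dynamic Schrödinger problem $$H(P|R)\to\min;\qquad P\in\mathrm{P}(\Omega):\ P_0=\mu_0,\ P_1=\mu_1$$ admits a solution $\widehat P$, then $\widehat P$ is also Markov.
   Context: For a measurable space $Y$, $\mathrm{P}(Y)$ and $\mathrm{M}_+(Y)$ are the sets of probability measures and of positive measures on $Y$. $\mathcal{X}$ is a Polish space with its Borel $\sigma$-field; $\Omega$ is either $C([0,1],\mathcal{X})$ or the space $D([0,1],\mathcal{X})$ of càdlàg paths (Skorokhod topology), with the $\sigma$-field generated by the canonical process $X_t(\omega)=\omega_t$, $0\le t\le1$. For $Q\in\mathrm{M}_+(\Omega)$, $Q_t:=(X_t)_\#Q$. $X_{[s,t]}$ denotes $(X_u)_{s\le u\le t}$. The reference path measure $R$ is a nonzero $\sigma$-finite measure, possibly of infinite mass. A solution is a minimizer with finite value. Markov: $Q\in\mathrm{M}_+(\Omega)$ is Markov if some time marginal $Q_{t_o}$ ($0\le t_o\le1$) is $\sigma$-finite and for each $0\le t\le1$, $Q(X_{[0,t]}\in\cdot,\,X_{[t,1]}\in\cdot\cdot\mid X_t)=Q(X_{[0,t]}\in\cdot\mid X_t)\,Q(X_{[t,1]}\in\cdot\cdot\mid X_t)$. Relative entropy: for a $\sigma$-finite positive measure $r$ and $p\in\mathrm{P}(Y)$, $H(p|r):=\int_Y\log(dp/dr)\,dp\in(-\infty,\infty]$ if $p\ll r$ and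 the integral is meaningful, and $H(p|r)=\infty$ otherwise. If $r$ is a probability measure the integral is always meaningful. In general it is meaningful when there is a measurable $W:Y\to[1,\infty)$ with $z_W:=\int_Y e^{-W}dr<\infty$ and $\int_Y W\,dp<\infty$; then $H(p|r)=H(p|r_W)-\int_Y W\,dp-\log z_W$ with $r_W:=z_W^{-1}e^{-W}r$. *)

(* Defs.v *)
From HB Require Import structures.
From mathcomp Require Import all_boot all_order all_algebra.
From mathcomp Require Import all_classical all_reals all_analysis.

Set Implicit Arguments.
Unset Strict Implicit.
Unset Printing Implicit Defensive.

Import Order.TTheory GRing.Theory Num.Theory.
Import numFieldNormedType.Exports.

Local Open Scope classical_set_scope.
Local Open Scope ring_scope.

#[short(type="completeMetricType")]
HB.structure Definition CompleteMetric (R : numDomainType) :=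
  {M of Complete M & Metric R M}.

Definition polish (R : realType) (X : topologicalType) : Prop :=
  (exists2 S : set X, countable S & dense S) /\
  exists (M : completeMetricType R) (f : X -> M) (g : M -> X),
    [/\ cancel f g, cancel g f, continuous f & continuous g].

Definition borel (X : ptopologicalType) := g_sigma_algebraType (@open X).

HB.instance Definition _ (X : ptopologicalType) := Measurable.on (borel X).

Section paths.
Variables (R : realType) (X : ptopologicalType).

Definition time : Type := set_type [set` `[0%R, 1%R : R]].

HB.instance Definition _ := Topological.on time.

Lemma time0_subproof : (0 : R) \in [set` `[0%R, 1%R : R]].
Proof. by rewrite inE /= in_itv /= lexx ler01. Qed.

Lemma time1_subproof : (1 : R) \in [set` `[0%R, 1%R : R]].
Proof. by rewrite inE /= in_itv /= ler01 lexx. Qed.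

Definition time0 : time := exist _ 0 time0_subproof.
Definition time1 : time := exist _ 1 time1_subproof.

(* At the endpoints one of the two one-sided filters is the trivial filter, for
   which the corresponding requirement holds vacuously. *)
Definition cadlag (w : time -> X) : Prop := forall t : time,
  w u @[u --> within [set u | \val t < \val u] (nbhs t)] --> w t /\
  exists l : X, w u @[u --> within [set u | \val u < \val t] (nbhs t)] --> l.

Variant path_class := ContinuousPaths | CadlagPaths.

Definition path_set (k : path_class) : set (time -> X) :=
  match k with
  | ContinuousPaths => [set w | continuous w]
  | CadlagPaths => [set w | cadlag w]
  end.

Variable k : path_class.

Definition trajectory : Type := set_type (path_set k).

HB.instance Definition _ := Choice.on trajectory.

Lemma cst_path_subproof : cst (point : X) \in path_set k.
Proof.
rewrite inE; case: k => /=; first exact: cst_continuous.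
by move=> t; split; [|exists point]; exact: cvg_cst.
Qed.

HB.instance Definition _ :=
  isPointed.Build trajectory (exist _ (cst point) cst_path_subproof).

Definition coord (t : time) (w : trajectory) : borel X := \val w t.

Definition cylinders (I : set time) : set (set trajectory) :=
  \bigcup_(u in I) preimage_set_system setT (coord u) measurable.

Definition path_space : Type := g_sigma_algebraType (cylinders setT).

HB.instance Definition _ := Measurable.on path_space.

Definition canonical_process (t : time) : path_space -> borel X := coord t.

(* The sigma-field generated by (X_u), u in I. *)
Definition process_sigma (I : set time) : set (set path_space) :=
  <<s cylinders I >>.

Definition past (t : time) := process_sigma [set u | \val u <= \val t].
Definition future (t : time) := process_sigma [set u | \val t <= \val u].

Definition marginal (Q : {measure set path_space -> \bar R}) (t : time) :
    set (borel X) -> \bar R :=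
  pushforward Q (canonical_process t).

(* The random variable f(X_t) is a version of Q(A | X_t). *)
Definition is_cond_prob (Q : {measure set path_space -> \bar R}) (t : time)
    (A : set path_space) (f : borel X -> R) : Prop :=
  [/\ measurable_fun setT f, forall x, 0 <= f x <= 1 &
      forall C : set (borel X), measurable C ->
        (\int[Q]_(w in canonical_process t @^-1` C)
          (f (canonical_process t w))%:E)%E =
        Q (A `&` canonical_process t @^-1` C)].

(* For a sigma-finite Q, requiring versions of these conditional probabilities
   to exist for all events forces every marginal of Q to be sigma-finite, so
   that versions are unique almost everywhere: if Q_s is sigma-finite, with s <=
   t say, and {X_s \in K_n} has finite mass, with version f_n, then the sets
   {f_n > 1/m} have finite mass for Q_t and their union has full mass. *)
Definition is_markov (Q : {measure set path_space -> \bar R}) : Prop :=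
  (exists t0 : time, sigma_finite setT (marginal Q t0)) /\
  forall (t : time) (A B : set path_space), past t A -> future t B ->
    exists f g h : borel X -> R,
      [/\ is_cond_prob Q t A f, is_cond_prob Q t B g,
          is_cond_prob Q t (A `&` B) h &
          {ae Q, forall w, h (canonical_process t w) =
            f (canonical_process t w) * g (canonical_process t w)}].

End paths.

Section entropy.
Variables (d : measure_display) (T : measurableType d) (R : realType).
Local Open Scope ereal_scope.
Local Open Scope charge_scope.

Definition log_density (p : probability T R)
    (r : {sigma_finite_measure set T -> \bar R}) (x : T) : \bar R :=
  lne (('d (charge_of_finite_measure p) '/d r) x).

(* The integral of log(dp/dr) is meaningful, as an element of ]-oo, +oo], when
   the negative part of the integrand has a finite integral; this is equivalent
   to the existence of a measurable W >= 1 with \int e^-W dr and \int W dp finite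
   (take W := max(1, - log(dp/dr)) on {dp/dr > 0}, and W large elsewhere). *)
Definition relative_entropy (p : probability T R)
    (r : {sigma_finite_measure set T -> \bar R}) : \bar R :=
  if `[< p `<< r /\ \int[p]_x (log_density p r)^\- x < +oo >]
  then \int[p]_x log_density p r x else +oo.

End entropy.

Section schrodinger.
Variables (R : realType) (X : ptopologicalType) (k : path_class).
Local Notation Omega := (path_space R X k).
Variables (Q : {sigma_finite_measure set Omega -> \bar R})
  (mu0 mu1 : probability (borel X) R).

Definition schrodinger_feasible (P : probability Omega R) : Prop :=
  forall C : set (borel X), measurable C ->
    marginal P (time0 R) C = mu0 C /\ marginal P (time1 R) C = mu1 C.

Definition schrodinger_solution (P : probability Omega R) : Prop :=
  [/\ schrodinger_feasible P, relative_entropy P Q \is a fin_num &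
      forall P' : probability Omega R, schrodinger_feasible P' ->
        (relative_entropy P Q <= relative_entropy P' Q)%E].

End schrodinger.

(* Main.v *)
Require Import Defs.
From HB Require Import structures.
From mathcomp Require Import all_boot all_order all_algebra.
From mathcomp Require Import all_classical all_reals all_analysis.
From mathcomp Require Import measurable_realfun.
From mathcomp Require Import ring lra.

(* Fix t and write P = z Q.  Let e(X_t) be the density of the law of X_t under P
   with respect to Q, and let zu(X_[0,t]) e(X_t) and zv(X_[t,1]) e(X_t) be those of
   the past and of the future.  Since Q is Markov, z' = zu zv e is the density of
   the law P' under which past and future have the same laws as under P but are
   independent given X_t.  Formally, H(P|Q) - H(P'|Q) = H(P|P'), so that minimality
   forces P = P'.  When Q has infinite mass, H(P'|Q) may be meaningless even though
   H(P|Q) is finite; so z is replaced by z' only on the event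
   1/n <= e(X_t) <= n, on which log e(X_t) is bounded.  This splicing still
   preserves the laws of the past and of the future, and letting n tend to infinity
   gives z = z' almost everywhere. *)

Set Implicit Arguments.
Unset Strict Implicit.
Unset Printing Implicit Defensive.

Import Order.TTheory GRing.Theory Num.Theory.
Import numFieldNormedType.Exports.

Local Open Scope classical_set_scope.
Local Open Scope ring_scope.

(** * Measures with a density *)

(** Two obstacles shape the argument. Finiteness of H(P|Q) makes log z integrable but says nothing
    of log zu and log zv separately, whereas the comparison of entropies integrates them one by one.
    Taking zu and zv as densities with respect to e(X_t) Q, a measure of mass 1, yields E_P[1/zu] <=
    1 and E_P[1/zv] <= 1, which control the logarithms from below; the control from above comes from
    z'/z, whose integral under P over the splicing event is at most the probability of that event.
    The identity of entropies itself is never written: the inequality exp(d) >= 1 + d and its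
    equality case take its place. Secondly, minimality gives z = z' only P-almost everywhere, which
    is silent where z = 0; that z' Q also has mass 1 excludes any further mass there. The core is
    stated for maps p, q, x on an arbitrary space, with x a function of p and also of q; paths enter
    only at the end, through X_0 lying in the past and X_1 in the future of every t. *)

Lemma measurable_preimage d dW (T : measurableType d) (W : measurableType dW)
    (s : T -> W) (A : set W) :
  measurable_fun setT s -> measurable A -> measurable (s @^-1` A).
Proof. by move=> ms mA; rewrite -[X in measurable X]setTI; exact: ms. Qed.

Lemma measurable_EFinS d (T : measurableType d) (R : realType) (A : set T)
    (f : T -> R) :
  measurable A -> measurable_fun setT f -> measurable_fun A (fun w => (f w)%:E).
Proof.
by move=> mA mf; apply: (measurable_funS measurableT) => //; exact/measurable_EFinP.
Qed.

Lemma indic_preimage (T W : Type) (R : pzRingType) (s : T -> W) (A : set W) (w : T) :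
  \1_(s @^-1` A) w = \1_A (s w) :> R.
Proof.
by rewrite !indicE; congr (_%:R); congr nat_of_bool; apply/idP/idP; rewrite !inE.
Qed.

Section density_measure.
Context d (T : measurableType d) (R : realType).
Variables (m : {measure set T -> \bar R}) (f : T -> R).
Hypotheses (mf : measurable_fun setT f) (f0 : forall w, 0 <= f w).

(* The proofs are phantom arguments from which the measure structure is built. *)
Definition density_measure of measurable_fun setT f & (forall w, 0 <= f w) :
    set T -> \bar R :=
  fun A => (\int[m]_(w in A) (f w)%:E)%E.

Local Notation nu := (density_measure mf f0).

Let nu0 : nu set0 = 0%E.
Proof. exact: integral_set0. Qed.

Let nu_ge0 A : (0 <= nu A)%E.
Proof. by apply: integral_ge0 => w _; rewrite lee_fin. Qed.

Let nu_sigma_additive : semi_sigma_additive nu.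
Proof.
move=> F mF tF mUF.
rewrite /density_measure ge0_integral_bigcup//; last 2 first.
- exact: measurable_EFinS.
- by move=> w _; rewrite lee_fin.
apply: is_cvg_ereal_nneg_natsum_cond => n _ _.
by apply: integral_ge0 => w _; rewrite lee_fin.
Qed.

HB.instance Definition _ := isMeasure.Build _ _ _ nu nu0 nu_ge0 nu_sigma_additive.

Import HBNNSimple.

(** For an indicator this is the definition of the measure; simple functions and monotone
    convergence do the rest. *)
Lemma integral_density (g : T -> R) : measurable_fun setT g ->
  (forall w, 0 <= g w) ->
  (\int[nu]_w (g w)%:E = \int[m]_w (g w * f w)%:E)%E.
Proof.
move=> mg g0.
have mg' : measurable_fun setT (EFin \o g) by exact/measurable_EFinP.
pose h := nnsfun_approx measurableT mg'.
have gE w : (g w)%:E = (limn (fun n => (h n w)%:E))%E.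
  apply/esym/cvg_lim => //.
  apply: (@cvg_nnsfun_approx _ _ _ _ measurableT _ mg') => //.
  by move=> ? _; rewrite lee_fin.
transitivity (limn (fun n => \int[nu]_w (h n w)%:E))%E.
  rewrite -monotone_convergence//.
  - by apply: eq_integral => w _; rewrite gE.
  - by move=> n; exact/measurable_EFinP.
  - by move=> n w _; rewrite lee_fin.
  - by move=> w _ a b ab; rewrite lee_fin; exact/lefP/nd_nnsfun_approx.
transitivity (limn (fun n => \int[m]_w (h n w * f w)%:E))%E; last first.
  rewrite -monotone_convergence//.
  - apply: eq_integral => w _; rewrite EFinM gE; apply/cvg_lim => //.
    under eq_fun do rewrite EFinM.
    apply: cvgeZr => //; rewrite -gE.
    apply: (@cvg_nnsfun_approx _ _ _ _ measurableT _ mg') => //.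
    by move=> ? _; rewrite lee_fin.
  - by move=> n; apply/measurable_EFinP; exact: measurable_funM.
  - by move=> n w _; rewrite lee_fin mulr_ge0.
  - move=> w _ a b ab; rewrite lee_fin ler_wpM2r//.
    exact/lefP/nd_nnsfun_approx.
apply: congr_lim; apply/funext => n.
transitivity (\int[nu]_w (\sum_(y \in range (h n))
    (y * \1_(h n @^-1` [set y]) w)%:E))%E.
  by apply: eq_integral => w _; rewrite fimfunE -fsumEFin.
transitivity (\int[m]_w (\sum_(y \in range (h n))
    (y * \1_(h n @^-1` [set y]) w * f w)%:E))%E; last first.
  by apply: eq_integral => w _; rewrite fsumEFin// -mulr_fsuml -fimfunE.
rewrite ge0_integral_fsum//; last 2 first.
- by move=> y; apply/measurable_EFinP; exact: measurable_funM.
- by move=> y w _; exact: nnfun_muleindic_ge0.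
rewrite ge0_integral_fsum//; last 2 first.
- move=> y; apply/measurable_EFinP; apply: measurable_funM => //.
  exact: measurable_funM.
- by move=> y w _; rewrite EFinM mule_ge0 ?lee_fin//; exact: nnfun_muleindic_ge0.
apply: eq_fsbigr => y /[!inE] -[w0 _ hy].
have y0 : 0 <= y by rewrite -hy.
under eq_integral do rewrite EFinM.
under [in RHS]eq_integral do rewrite -mulrA EFinM.
rewrite ge0_integralZl//; last exact/measurable_EFinP.
rewrite ge0_integralZl//; last 2 first.
- by apply/measurable_EFinP; exact: measurable_funM.
- by move=> w _; rewrite lee_fin mulr_ge0.
rewrite integral_indic// setIT; congr (_ * _)%E.
rewrite /density_measure [LHS]integral_mkcond; apply: eq_integral => w _.
by rewrite patchE indicE; case: ifPn => _; rewrite ?mul1r ?mul0r.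
Qed.

End density_measure.

Section integral_comp.
Context d dU (T : measurableType d) (U : measurableType dU) (R : realType).
Local Open Scope ereal_scope.

Lemma integral_indic_mul (m : {measure set T -> \bar R}) (f : T -> R) (A : set T) :
  \int[m]_(w in A) (f w)%:E = \int[m]_w (\1_A w * f w)%:E.
Proof.
rewrite integral_mkcond; apply: eq_integral => w _.
by rewrite patchE indicE; case: ifPn => _; rewrite ?mul1r ?mul0r.
Qed.

(** The hypothesis says that the measures [b1 m1] and [b2 m2] have the same image under [p], so they
    integrate functions of [p] alike. This is the device by which every identity on events below is
    extended to functions. *)
Lemma eq_integral_comp_mul (m1 m2 : {measure set T -> \bar R}) (p : T -> U)
    (b1 b2 : T -> R) :
  measurable_fun setT p ->
  measurable_fun setT b1 -> (forall w, (0 <= b1 w)%R) ->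
  measurable_fun setT b2 -> (forall w, (0 <= b2 w)%R) ->
  (forall A, measurable A -> \int[m1]_(w in p @^-1` A) (b1 w)%:E =
                             \int[m2]_(w in p @^-1` A) (b2 w)%:E) ->
  forall a : U -> R, measurable_fun setT a -> (forall u, (0 <= a u)%R) ->
  \int[m1]_w (a (p w) * b1 w)%:E = \int[m2]_w (a (p w) * b2 w)%:E.
Proof.
move=> mp mb1 b10 mb2 b20 b12 a ma a0.
have map : measurable_fun setT (a \o p) by exact: measurableT_comp.
have ap0 w : (0 <= (a \o p) w)%R by exact: a0.
rewrite -(integral_density m1 mb1 b10 map ap0).
rewrite -(integral_density m2 mb2 b20 map ap0).
have pushE (m : {measure set T -> \bar R}) :
    \int[m]_w ((a \o p) w)%:E = \int[pushforward m p]_u (a u)%:E.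
  rewrite (ge0_integral_pushforward mp)//; last by move=> u _; rewrite lee_fin.
  exact/measurable_EFinP.
rewrite 2!pushE.
pose p' : {mfun T >-> U} := HB.pack p (isMeasurableFun.Build _ _ _ _ p mp).
rewrite -[p]/(p' : T -> U).
by apply: eq_measure_integral => A mA _; exact: b12.
Qed.

End integral_comp.

Section real_density.
Context d (T : measurableType d) (R : realType).
Local Open Scope ereal_scope.

Lemma exists_density (p : {finite_measure set T -> \bar R})
    (r : {sigma_finite_measure set T -> \bar R}) : p `<< r ->
  exists z : T -> R, [/\ measurable_fun setT z, (forall w, (0 <= z w)%R) &
    forall A, measurable A -> p A = \int[r]_(w in A) (z w)%:E].
Proof.
move=> pr; exists (fine \o Radon_Nikodym_SigmaFinite.f p r).
have fE w : (fine (Radon_Nikodym_SigmaFinite.f p r w))%:E =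
    Radon_Nikodym_SigmaFinite.f p r w.
  by rewrite fineK// Radon_Nikodym_SigmaFinite.f_fin_num.
split.
- apply: measurableT_comp => //.
  exact: measurable_int (Radon_Nikodym_SigmaFinite.f_integrable pr).
- by move=> w; apply: fine_ge0; exact: Radon_Nikodym_SigmaFinite.f_ge0.
- move=> A mA; rewrite (Radon_Nikodym_SigmaFinite.f_integral pr)//.
  by apply: eq_integral => w _; rewrite /= fE.
Qed.

Local Open Scope charge_scope.

(** Densities are unique [r]-almost everywhere; by domination this holds [p]-almost everywhere,
    which is what counts in an entropy, an integral against [p]. *)
Lemma Radon_Nikodym_ae_density (p : {finite_measure set T -> \bar R})
    (r : {sigma_finite_measure set T -> \bar R}) (z : T -> R) :
  measurable_fun setT z -> (forall w, (0 <= z w)%R) -> 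
  (forall A, measurable A -> p A = \int[r]_(w in A) (z w)%:E) ->
  p `<< r /\ {ae p, forall w, ('d (charge_of_finite_measure p) '/d r) w = (z w)%:E}.
Proof.
move=> mz z0 pE.
have mz' : measurable_fun setT (EFin \o z) by exact/measurable_EFinP.
have pr : p `<< r.
  apply/null_content_dominatesP => A mA rA0; rewrite pE//.
  by apply: null_set_integral => //; exact: measurable_funTS.
have rz : ae_eq r setT ('d (charge_of_finite_measure p) '/d r) (EFin \o z).
  apply: integral_ae_eq => // [|A _ mA]; first exact: Radon_Nikodym_integrable.
  by rewrite -Radon_Nikodym_integral// -pE.
split => //; have := null_dominates_ae_eq measurableT pr rz.
by apply: filterS => w /(_ I).
Qed.

End real_density.

(** * Conditional probability and conditional independence *)

Section sigma_finite_copy.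
Context d (T : measurableType d) (R : realType) (m : {measure set T -> \bar R}).

(** An alias of [m] indexed by the proof, so that the sigma-finite structure can be attached to a
    measure known to be sigma-finite only by hypothesis. *)
Definition sigma_finite_copy of sigma_finite setT m : set T -> \bar R := m.

Hypothesis m_sfin : sigma_finite setT m.

HB.instance Definition _ := Measure.on (sigma_finite_copy m_sfin).
HB.instance Definition _ :=
  Measure_isSigmaFinite.Build _ _ _ (sigma_finite_copy m_sfin) m_sfin.

End sigma_finite_copy.

Section conditional_probability.
Context d dE (T : measurableType d) (E : measurableType dE) (R : realType).
Local Open Scope ereal_scope.

(** For [x := canonical_process t] this unfolds to [is_cond_prob]. *)
Definition cond_prob (m : {measure set T -> \bar R}) (x : T -> E) (A : set T)
    (f : E -> R) : Prop :=
  [/\ measurable_fun setT f, forall y, (0 <= f y <= 1)%R &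
      forall C, measurable C ->
        \int[m]_(w in x @^-1` C) (f (x w))%:E = m (A `&` x @^-1` C)].

Lemma cond_prob_integral (m : {measure set T -> \bar R}) (x : T -> E)
    (A : set T) (f : E -> R) :
  measurable_fun setT x -> measurable A -> cond_prob m x A f ->
  forall c : E -> R, measurable_fun setT c -> (forall y, (0 <= c y)%R) ->
  \int[m]_w (c (x w) * f (x w))%:E = \int[m]_w (c (x w) * \1_A w)%:E.
Proof.
move=> mx mA [mf f01 fE] c mc c0.
have f0 y : (0 <= f y)%R by have /andP[] := f01 y.
apply: (eq_integral_comp_mul (p := x) (b1 := f \o x)) => //.
- exact: measurableT_comp.
- by move=> w; exact: f0.
- move=> C mC; rewrite fE// integral_indic//.
  exact: measurable_preimage.
Qed.

Lemma pushforward_measure (m : {measure set T -> \bar R}) (x : T -> E) :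
  measurable_fun setT x ->
  exists nu : {measure set E -> \bar R}, nu = pushforward m x :> (set E -> \bar R).
Proof.
by move=> mx; unshelve eexists (pushforward m x : {measure set E -> \bar R}).
Qed.

(** Radon-Nikodym is applied on [E] to the two image measures, so the density is a function of [x]
    and only null sets of the form [x] in C matter. *)
Lemma exists_density_comp (n m : {measure set T -> \bar R}) (x : T -> E) :
  measurable_fun setT x -> n setT < +oo -> sigma_finite setT (pushforward m x) ->
  (forall C, measurable C -> m (x @^-1` C) = 0 -> n (x @^-1` C) = 0) ->
  exists f : E -> R, [/\ measurable_fun setT f, forall y, (0 <= f y)%R &
    forall C, measurable C -> n (x @^-1` C) = \int[m]_(w in x @^-1` C) (f (x w))%:E].
Proof.
move=> mx n_fin m_sfin nm.
have mxC C : measurable C -> measurable (x @^-1` C) by exact: measurable_preimage.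
have [n1 n1E] := pushforward_measure n mx.
have [m1 m1E] := pushforward_measure m mx.
have n1_fin : n1 setT < +oo by rewrite n1E /pushforward preimage_setT.
have m1_sfin : sigma_finite setT m1 by rewrite m1E.
pose n2 : {finite_measure set E -> \bar R} := mfrestr measurableT n1_fin.
pose m2 : {sigma_finite_measure set E -> \bar R} := sigma_finite_copy m1_sfin.
have n2E C : n2 C = n (x @^-1` C) by rewrite /n2/= /mfrestr /mrestr/= setIT n1E.
have : n2 `<< m2.
  apply/null_content_dominatesP => C mC; rewrite n2E /m2 /= /sigma_finite_copy m1E.
  exact: nm.
move=> /exists_density[f [mf f0 fE]]; exists f; split => // C mC.
rewrite -n2E fE//= /sigma_finite_copy m1E (ge0_integral_pushforward mx)//.
- exact: measurable_EFinS.
- by move=> y _; rewrite lee_fin.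
Qed.

Lemma sigma_finite_pushforward (m : {measure set T -> \bar R}) (x : T -> E) :
  m setT < +oo -> sigma_finite setT (pushforward m x).
Proof.
move=> m_fin; exists (fun=> setT) => [|_]; last by split.
by rewrite bigcup_const//; exists 0%N.
Qed.

(** Radon-Nikodym bounds the density by 1 only almost everywhere, while [cond_prob] asks for the
    bound everywhere, hence the truncation at 1. It changes nothing almost everywhere, because the
    densities [f] of [A] and [g] of its complement add up to 1. *)
Lemma cond_prob_exists (P : probability T R) (x : T -> E) (A : set T) :
  measurable_fun setT x -> measurable A -> exists f, cond_prob P x A f.
Proof.
move=> mx mA.
have mxC C : measurable C -> measurable (x @^-1` C) by exact: measurable_preimage.
have PT_fin : P setT < +oo by rewrite probability_setT ltry.
have dens (B : set T) : measurable B -> exists f : E -> R,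
    [/\ measurable_fun setT f, forall y, (0 <= f y)%R &
    forall C, measurable C ->
      P (B `&` x @^-1` C) = \int[P]_(w in x @^-1` C) (f (x w))%:E].
  move=> mB.
  have [||||f [mf f0 fE]] := @exists_density_comp (mrestr P mB) P x => //.
  - rewrite /mrestr; apply: (le_lt_trans _ PT_fin).
    by apply: le_measure; rewrite ?inE//; exact: measurableI.
  - exact: sigma_finite_pushforward.
  - move=> C mC PC0; apply/eqP; rewrite -measure_le0 -PC0.
    apply: le_measure; rewrite ?inE//; last exact: mxC.
    by apply: measurableI => //; exact: mxC.
  - by exists f; split => // C mC; rewrite -fE// setIC.
have [f [mf f0 fE]] := dens A mA.
have [g [mg g0 gE]] := dens (~` A) (measurableC mA).
have [nu nuE] := pushforward_measure P mx.
have fg1 : ae_eq nu setT (cst 1) (fun y => (f y + g y)%:E).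
  apply: integral_ae_eq => //.
  - apply/integrableP; split => //.
    rewrite nuE (ge0_integral_pushforward mx)//= normr1.
    by rewrite preimage_setT integral_cst// mul1e.
  - by apply/measurable_EFinP; exact: measurable_funD.
  - move=> C _ mC; rewrite nuE !(ge0_integral_pushforward mx)//=.
    + rewrite integral_cst//; last exact: mxC.
      under eq_integral do rewrite EFinD.
      rewrite ge0_integralD//.
      rewrite -fE// -gE// mul1e -measureU.
      * by rewrite -setIUl setUCr setTI.
      * by apply: measurableI => //; exact: mxC.
      * by apply: measurableI; [exact: measurableC|exact: mxC].
      * by rewrite setIACA setICr set0I.
      * exact: mxC.
      * by move=> w _; rewrite lee_fin.
      * by apply: measurable_EFinS; [exact: mxC|exact: measurableT_comp].
      * by move=> w _; rewrite lee_fin.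
      * by apply: measurable_EFinS; [exact: mxC|exact: measurableT_comp].
    + by apply: measurable_EFinS => //; exact: measurable_funD.
    + by move=> y _; rewrite lee_fin addr_ge0.
exists (fun y => Num.min (f y) 1)%R; split.
- exact: measurable_minr.
- by move=> y; rewrite le_min f0 ler01 ge_min lexx orbT.
- move=> C mC; apply: etrans (esym (fE C mC)).
  have [N [mN N0 fgN]] := fg1.
  apply: ge0_ae_eq_integral => //.
  - exact: mxC.
  - apply: measurable_EFinS; first exact: mxC.
    by apply: measurable_minr => //; exact: measurableT_comp.
  - by apply: measurable_EFinS; [exact: mxC|exact: measurableT_comp].
  - by move=> w _; rewrite lee_fin le_min f0 ler01.
  - by move=> w _; rewrite lee_fin.
  - exists (x @^-1` N); split; [exact: mxC|by move: N0; rewrite nuE|].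
    move=> w fw; apply: fgN => fg; apply: fw => /= _.
    have {}fg : (1 = f (x w) + g (x w))%R := congr1 fine (fg I).
    by rewrite min_l// fg lerDl.
Qed.

End conditional_probability.

Section conditional_independence.
Context d dU dV dE (T : measurableType d) (U : measurableType dU)
  (V : measurableType dV) (E : measurableType dE) (R : realType).
Local Open Scope ereal_scope.

(** Only the total integral is tested, not its restriction to events of [x]. When [x] is a function
    of [p], these are covered too: an event of [x] can be absorbed into [A]. *)
Definition cond_indep (m : {measure set T -> \bar R})
    (p : T -> U) (q : T -> V) (x : T -> E) : Prop :=
  forall (A : set U) (B : set V), measurable A -> measurable B ->
  exists f g : E -> R,
    [/\ cond_prob m x (p @^-1` A) f, cond_prob m x (q @^-1` B) g &
        \int[m]_w (f (x w) * g (x w))%:E = m (p @^-1` A `&` q @^-1` B)].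

(** The hypothesis on [b] and [e] makes [e(x)] the conditional expectation of [b(q)] given [x]; by
    conditional independence it may replace [b(q)] against any function of [p]. For the indicator of
    an event of [p], that indicator is exchanged for its conditional probability [f0(x)], then
    [b(q)] for [e(x)], and then [f0(x)] back for the indicator. *)
Lemma cond_indep_integral (m : {measure set T -> \bar R})
    (p : T -> U) (q : T -> V) (x : T -> E) :
  measurable_fun setT p -> measurable_fun setT q -> measurable_fun setT x ->
  cond_indep m p q x ->
  forall (b : V -> R) (e : E -> R),
    measurable_fun setT b -> (forall v, (0 <= b v)%R) ->
    measurable_fun setT e -> (forall y, (0 <= e y)%R) ->
    (forall C, measurable C -> \int[m]_(w in x @^-1` C) (b (q w))%:E =
                               \int[m]_(w in x @^-1` C) (e (x w))%:E) ->
  forall a : U -> R, measurable_fun setT a -> (forall u, (0 <= a u)%R) ->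
  \int[m]_w (a (p w) * b (q w))%:E = \int[m]_w (a (p w) * e (x w))%:E.
Proof.
move=> mp mq mx ind b e mb b0 me e0 be.
have mbq : measurable_fun setT (b \o q) by exact: measurableT_comp.
have mex : measurable_fun setT (e \o x) by exact: measurableT_comp.
have mpA A : measurable A -> measurable (p @^-1` A) by exact: measurable_preimage.
have mqB B : measurable B -> measurable (q @^-1` B) by exact: measurable_preimage.
have flip (f g : T -> R) :
    \int[m]_w (f w * g w)%:E = \int[m]_w (g w * f w)%:E.
  by apply: eq_integral => w _; rewrite mulrC.
apply: (eq_integral_comp_mul (p := p) (b1 := b \o q) (b2 := e \o x)) => //.
- by move=> w; exact: b0.
- by move=> w; exact: e0.
move=> A mA.
(* [cond_indep] may provide a different version for each pair of events. Fixing the one obtained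
   with [setT] gives an [f0] that serves all [B]. *)
have [f0 [_ [f0A _ _]]] := ind A setT mA measurableT.
have [mf0 f01 _] := f0A.
have f00 y : (0 <= f0 y)%R by have /andP[] := f01 y.
have mf0x : measurable_fun setT (f0 \o x) by exact: measurableT_comp.
have f0B B : measurable B ->
    m (p @^-1` A `&` q @^-1` B) = \int[m]_(w in q @^-1` B) (f0 (x w))%:E.
  move=> mB; have [f [g [fA gB <-]]] := ind A B mA mB.
  have [mf f1 _] := fA; have [mg g1 _] := gB.
  have g0 y : (0 <= g y)%R by have /andP[] := g1 y.
  (* The integral of [f g] becomes in turn those of [1_A g], [f0 g] and [f0 1_B]. *)
  rewrite flip (cond_prob_integral mx (mpA _ mA) fA mg g0).
  rewrite -(cond_prob_integral mx (mpA _ mA) f0A mg g0) flip.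
  rewrite (cond_prob_integral mx (mqB _ mB) gB mf0 f00) flip.
  by rewrite -integral_indic_mul.
rewrite [LHS]integral_indic_mul [RHS]integral_indic_mul.
rewrite flip (eq_integral_comp_mul (p := q) (m2 := m) (b2 := f0 \o x))//; first last.
- move=> B mB; rewrite -f0B// integral_indic//; [exact: mqB|exact: mpA].
- by move=> w; exact: f00.
- by apply: measurable_indic; exact: mpA.
rewrite flip (eq_integral_comp_mul (p := x) (m2 := m)
  (b1 := b \o q) (b2 := e \o x))//; first last.
- by move=> w; exact: e0.
- by move=> w; exact: b0.
by rewrite flip (cond_prob_integral mx (mpA _ mA) f0A me e0) flip.
Qed.

End conditional_independence.

Lemma cond_indep_sym d dU dV dE (T : measurableType d) (U : measurableType dU)
    (V : measurableType dV) (E : measurableType dE) (R : realType)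
    (m : {measure set T -> \bar R}) (p : T -> U) (q : T -> V) (x : T -> E) :
  cond_indep m p q x -> cond_indep m q p x.
Proof.
move=> ind B A mB mA; have [f [g [fA gB fg]]] := ind A B mA mB.
exists g, f; split=> //; rewrite setIC -fg.
by apply: eq_integral => w _; rewrite mulrC.
Qed.

(** * Relative entropy *)

Section gibbs.
Context d (T : measurableType d) (R : realType) (P : probability T R).
Local Open Scope ereal_scope.

Lemma le_integrable_EFin (K : set T) (f g : T -> R) : measurable K ->
  measurable_fun setT f -> P.-integrable K (EFin \o g) ->
  (forall w, K w -> (`|f w| <= g w)%R) -> P.-integrable K (EFin \o f).
Proof.
move=> mK mf ig fg; apply: le_integrable ig => //.
  exact: measurable_EFinS.
by move=> w Kw; rewrite /= lee_fin (le_trans (fg w Kw))// ler_norm.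
Qed.

Lemma integrable_expR (K : set T) (f : T -> R) : measurable K ->
  measurable_fun setT f -> \int[P]_(w in K) (expR (f w))%:E < +oo ->
  P.-integrable K (EFin \o (expR \o f)).
Proof.
move=> mK mf foo; apply/integrableP; split.
  apply: measurable_EFinS => //.
  exact: measurableT_comp.
by under eq_integral do rewrite /= ger0_norm ?expR_ge0//.
Qed.

(* With d = lz - (le + lu + lv), exp (- d) - 1 + d is nonnegative and vanishes only
   where d = 0; the three bounds on exponentials make lu and lv integrable on K. *)
Lemma gibbs_equality (K : set T) (lz le lu lv : T -> R) : measurable K ->
  measurable_fun setT lz -> measurable_fun setT le ->
  measurable_fun setT lu -> measurable_fun setT lv ->
  P.-integrable K (EFin \o lz) -> P.-integrable K (EFin \o le) ->
  \int[P]_(w in K) (expR (- lu w))%:E < +oo ->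
  \int[P]_(w in K) (expR (- lv w))%:E < +oo ->
  \int[P]_(w in K) (expR (le w + lu w + lv w - lz w))%:E <= P K ->
  (P.-integrable K (EFin \o lu) -> P.-integrable K (EFin \o lv) ->
    \int[P]_(w in K) (lz w)%:E <= \int[P]_(w in K) (le w + lu w + lv w)%:E) ->
  {ae P, forall w, K w -> lz w = (le w + lu w + lv w)%R}.
Proof.
move=> mK mlz mle mlu mlv ilz ile ulty vlty gK min.
pose D := (fun w => le w + lu w + lv w - lz w)%R.
pose g w := expR (D w).
rewrite -/(D _) in gK.
have mD : measurable_fun setT D.
  apply: measurable_funB => //; apply: measurable_funD => //.
  exact: measurable_funD.
have PK_fin : P K \is a fin_num by exact: fin_num_measure.
have ig : P.-integrable K (EFin \o g).
  apply: (integrable_expR (f := D)) => //.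
  by apply: (le_lt_trans gK); rewrite ltey_eq PK_fin.
have iu := integrable_expR mK (measurable_funN mlu) ulty.
have iv := integrable_expR mK (measurable_funN mlv) vlty.
have inorm f : P.-integrable K (EFin \o f) ->
    P.-integrable K (EFin \o (fun w => `|f w|%R)).
  exact: integrable_norm.
pose S w := (`|lz w| + `|le w| + expR (- lu w) + expR (- lv w) + g w)%R.
have iDE (f h : T -> R) : P.-integrable K (EFin \o f) ->
    P.-integrable K (EFin \o h) -> P.-integrable K (EFin \o (fun w => f w + h w)%R).
  by move=> fi hi; exact: (integrableD mK fi hi).
have iS : P.-integrable K (EFin \o S).
  exact: (iDE _ _ (iDE _ _ (iDE _ _ (iDE _ _ (inorm _ ilz) (inorm _ ile))
    iu) iv) ig).
have expR_ge (y : R) : (1 + y <= expR y)%R by exact: expR_ge1Dx.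
(* From below, [- lu <= expR (- lu)]. From above, [lu = D + lz - le - lv], where [D <= g] and
   [- lv <= expR (- lv)]. The same holds with [lu] and [lv] exchanged. *)
have luvS w : (`|lu w| <= S w)%R /\ (`|lv w| <= S w)%R.
  have := expR_ge (- lu w)%R; have := expR_ge (- lv w)%R.
  have := expR_ge (D w); rewrite -/(g w) /D.
  have := expR_ge0 (- lu w)%R; have := expR_ge0 (- lv w)%R.
  have := expR_ge0 (D w); rewrite -/(g w).
  have := ler_norm (lz w); have := ler_norm (- lz w)%R; rewrite normrN.
  have := ler_norm (le w); have := ler_norm (- le w)%R; rewrite normrN.
  rewrite /S !ler_norml; move: (expR _) (expR _) (g w) => a b c *.
  by split; apply/andP; split; lra.
have ilu : P.-integrable K (EFin \o lu).
  by apply: (le_integrable_EFin _ _ iS) => // w _; case: (luvS w).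
have ilv : P.-integrable K (EFin \o lv).
  by apply: (le_integrable_EFin _ _ iS) => // w _; case: (luvS w).
have {}min := min ilu ilv.
have ieuv : P.-integrable K (EFin \o (fun w => le w + lu w + lv w)%R).
  exact: (iDE _ _ (iDE _ _ ile ilu) ilv).
have i1 : P.-integrable K (EFin \o cst 1%R).
  exact: finite_measure_integrable_cst.
(* This is [expR D - 1 - D], grouped into two integrable terms. The first integrates to at most
   [P K] plus the integral of [lz], the second to exactly [P K] plus that of [le + lu + lv], so
   [min] makes the integral of [F] nonpositive. *)
pose F w := ((g w + lz w) - (1 + (le w + lu w + lv w)))%R.
have F0 w : (0 <= F w)%R.
  by rewrite subr_ge0; have := expR_ge (D w); rewrite -/(g w) /D; lra.
have mF : measurable_fun setT F.
  apply: measurable_funB.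
    by apply: measurable_funD => //; exact: measurableT_comp.
  apply: measurable_funD => //; apply: measurable_funD => //.
  exact: measurable_funD.
have igz : P.-integrable K (EFin \o (fun w => g w + lz w)%R) by exact: iDE.
have i1e : P.-integrable K (EFin \o (fun w => 1 + (le w + lu w + lv w))%R).
  exact: iDE.
have intF : \int[P]_(w in K) (F w)%:E <= 0.
  rewrite [X in X <= _](_ : _ = \int[P]_(w in K) (g w + lz w)%:E -
      \int[P]_(w in K) (1 + (le w + lu w + lv w))%:E); last first.
    by rewrite -integralB_EFin.
  rewrite (integralD_EFin mK ig ilz) (integralD_EFin mK i1 ieuv).
  have -> : \int[P]_(w in K) (cst 1%R w)%:E = P K.
    by rewrite -[RHS]mul1e -integral_cst.
  rewrite sube_le0.
  exact: leeD.
have F_ae0 : ae_eq P K (EFin \o F) (cst 0).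
  apply/ae_eq_integral_abs => //.
    exact: measurable_EFinS.
  under eq_integral do rewrite gee0_abs ?lee_fin//.
  by apply/eqP; rewrite eq_le intF integral_ge0// => w _; rewrite lee_fin.
apply: filterS F_ae0 => w /[apply] /= /(congr1 fine) /=; rewrite /F /g -/(D w) => Fw.
(* [F w = 0] means [expR (D w) = 1 + D w], which strict convexity allows only at 0. *)
have [D0|/expR_gt1Dx] := eqVneq (D w) 0%R; first by move: D0; rewrite /D; lra.
by move: Fw; rewrite {2}/D; lra.
Qed.

End gibbs.

Section entropy_density.
Context d (T : measurableType d) (R : realType).
Variables (p : probability T R) (r : {sigma_finite_measure set T -> \bar R}).
Local Open Scope ereal_scope.
Local Open Scope charge_scope.

Lemma density_ae_gt0 (m : {measure set T -> \bar R}) (z : T -> R) :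
  measurable_fun setT z -> (forall w, (0 <= z w)%R) ->
  (forall A, measurable A -> p A = \int[m]_(w in A) (z w)%:E) ->
  {ae p, forall w, (0 < z w)%R}.
Proof.
move=> mz z0 pE.
have mN : measurable (z @^-1` [set 0%R]) by exact: measurable_preimage.
exists (z @^-1` [set 0%R]); split => //.
  apply: etrans (pE _ mN) _.
  under eq_integral => w /[!inE] /= -> do [].
  by rewrite integral0.
by move=> w /= /negP; rewrite -leNgt => zw; apply/eqP; rewrite eq_le zw z0.
Qed.

Variable z : T -> R.
Hypotheses (mz : measurable_fun setT z) (z0 : forall w, (0 <= z w)%R).
Hypothesis pE : forall A, measurable A -> p A = \int[r]_(w in A) (z w)%:E.

Let pr : p `<< r.
Proof. by have [] := Radon_Nikodym_ae_density mz z0 pE. Qed.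

Let log_density_ae : ae_eq p setT (log_density p r) (fun w => (ln (z w))%:E).
Proof.
have [_ zE] := Radon_Nikodym_ae_density mz z0 pE.
have z_gt0 := density_ae_gt0 mz z0 pE.
apply: filterS2 zE z_gt0 => w zE w0 _.
by rewrite /log_density zE lne_EFin.
Qed.

Let measurable_log_density : measurable_fun setT (log_density p r).
Proof.
pose f := fine \o 'd (charge_of_finite_measure p) '/d r.
have mf : measurable_fun setT f.
  exact: measurableT_comp.
(* [lne] is -oo at nonpositive arguments, unlike the real-valued [ln]; hence the case split. *)
rewrite (_ : log_density p r =
    fun w => if (f w <= 0)%R then -oo else (ln (f w))%:E); last first.
  apply/funext => w; rewrite /log_density /f /=.
  by rewrite -[in LHS](fineK (@Radon_Nikodym_fin_num _ _ _
    (charge_of_finite_measure p) r w pr)).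
apply: measurable_fun_ifT => //.
- by apply: measurable_fun_ler.
- by apply/measurable_EFinP; exact: measurableT_comp.
Qed.

Let measurable_ln_z : measurable_fun setT (fun w => (ln (z w))%:E).
Proof. by apply/measurable_EFinP; exact: measurableT_comp. Qed.

Let integrable_log_density :
  p.-integrable setT (log_density p r) <->
  p.-integrable setT (fun w => (ln (z w))%:E).
Proof.
have absE : \int[p]_w `|log_density p r w| = \int[p]_w `|(ln (z w))%:E|.
  apply: ge0_ae_eq_integral => //; [exact: measurableT_comp..|].
  by apply: filterS log_density_ae => w /[apply] ->.
by split=> /integrableP[_ lty]; apply/integrableP; split => //;
  move: lty; rewrite absE.
Qed.

Lemma relative_entropy_density : p.-integrable setT (fun w => (ln (z w))%:E) ->
  relative_entropy p r = \int[p]_w (ln (z w))%:E.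
Proof.
move=> iz; rewrite /relative_entropy asboolT.
  exact: ae_eq_integral.
split => //; apply: integral_funeneg_lt_pinfty => //.
exact/integrable_log_density.
Qed.

Lemma relative_entropy_fin_num : relative_entropy p r \is a fin_num ->
  p.-integrable setT (fun w => (ln (z w))%:E).
Proof.
rewrite /relative_entropy; case: asboolP => // _ ld_fin.
apply/integrable_log_density/integrableP; split => //.
by apply/abse_integralP => //; rewrite -fin_num_abs.
Qed.

End entropy_density.

Lemma relative_entropy_null_dominates d (T : measurableType d) (R : realType)
    (p : probability T R) (r : {sigma_finite_measure set T -> \bar R}) :
  relative_entropy p r \is a fin_num -> p `<< r.
Proof. by rewrite /relative_entropy; case: asboolP => // -[]. Qed.

Section density_probability.
Context d (T : measurableType d) (R : realType) (m : {measure set T -> \bar R}).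
Variables (f : T -> R) (mf : measurable_fun setT f) (f0 : forall w, 0 <= f w).

Definition density_probability of density_measure m mf f0 setT = 1%E :
  set T -> \bar R := density_measure m mf f0.

Hypothesis f1 : density_measure m mf f0 setT = 1%E.

HB.instance Definition _ := Measure.on (density_probability f1).
HB.instance Definition _ :=
  Measure_isProbability.Build _ _ _ (density_probability f1) f1.

End density_probability.

Section same_law.
Context d dW (T : measurableType d) (W : measurableType dW) (R : realType).
Variables (P1 P2 : {measure set T -> \bar R}) (s : T -> W).
Hypotheses (ms : measurable_fun setT s)
  (P12 : forall A, measurable A -> P1 (s @^-1` A) = P2 (s @^-1` A)).
Variables (D : set W) (h : W -> R).
Hypotheses (mD : measurable D) (mh : measurable_fun setT h).
Local Open Scope ereal_scope.

Let mh' : measurable_fun setT (EFin \o h).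
Proof. exact/measurable_EFinP. Qed.

Lemma same_law_integrable : P1.-integrable (s @^-1` D) (EFin \o h \o s) ->
  P2.-integrable (s @^-1` D) (EFin \o h \o s).
Proof.
move=> /integrableP[_ lty]; apply/integrableP; split.
  by apply: (measurable_funS measurableT) => //; exact: measurableT_comp.
have absE (P : {measure set T -> \bar R}) :
    \int[P]_(w in s @^-1` D) `|(EFin \o h \o s) w| =
    \int[pushforward P s]_(y in D) `|(h y)%:E|.
  rewrite (ge0_integral_pushforward ms)//.
  apply: (measurable_funS measurableT) => //.
  exact: measurableT_comp.
rewrite absE; move: lty; rewrite absE.
have [nu1 nu1E] := pushforward_measure P1 ms.
have [nu2 nu2E] := pushforward_measure P2 ms.
rewrite -nu1E -nu2E (eq_measure_integral nu2)// => A mA _.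
by rewrite nu1E nu2E; exact: P12.
Qed.

Lemma same_law_integral : P1.-integrable (s @^-1` D) (EFin \o h \o s) ->
  \int[P1]_(w in s @^-1` D) (h (s w))%:E = \int[P2]_(w in s @^-1` D) (h (s w))%:E.
Proof.
move=> i1; have i2 := same_law_integrable i1.
have := integral_pushforward ms mh' i1 mD.
have := integral_pushforward ms mh' i2 mD.
have [nu1 nu1E] := pushforward_measure P1 ms.
have [nu2 nu2E] := pushforward_measure P2 ms.
rewrite -nu1E -nu2E (eq_measure_integral nu1); last first.
  by move=> A mA _; rewrite nu1E nu2E; exact/esym/P12.
by move=> -> ->.
Qed.

End same_law.

Section splice.
Context d (T : measurableType d) (R : realType).
Local Open Scope ereal_scope.

Lemma integrable_setC (m : {measure set T -> \bar R}) (K : set T) (f : T -> \bar R) :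
  measurable K -> measurable_fun setT f ->
  m.-integrable K f -> m.-integrable (~` K) f -> m.-integrable setT f.
Proof.
move=> mK mf /integrableP[_ fK] /integrableP[_ fCK]; apply/integrableP; split => //.
rewrite -(setUv K) ge0_integral_setU//.
- exact: lte_add_pinfty.
- exact: measurableC.
- by rewrite setUv; exact: measurableT_comp.
- by rewrite disj_set2E setICr.
Qed.

Lemma integral_setUC (m : {measure set T -> \bar R}) (K : set T) (f : T -> \bar R) :
  measurable K -> measurable_fun setT f ->
  \int[m]_w f w = \int[m]_(w in K) f w + \int[m]_(w in ~` K) f w.
Proof.
move=> mK mf; rewrite -(setUv K) integral_setU ?setUv//.
- exact: measurableC.
- by rewrite disj_set2E setICr.
Qed.

Lemma ae_eq_integrable (m : {measure set T -> \bar R}) (K : set T)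
    (f g : T -> \bar R) :
  measurable K -> measurable_fun K g -> ae_eq m K f g ->
  m.-integrable K f -> m.-integrable K g.
Proof.
move=> mK mg fg /integrableP[mf fK]; apply/integrableP; split => //.
rewrite -(ge0_ae_eq_integral (f := abse \o f))//; [exact: measurableT_comp..|
  by move=> w _ /=; exact: abse_ge0|].
by apply: filterS fg => w /[apply] /= ->.
Qed.

(** Off [K] the densities agree, so that part of the two entropies is the same finite number and
    cancels. [phi] stands for [ln z2] on [K], where the formula for it holds only [p2]-almost
    everywhere; its integrability ensures that the entropy of [p2] is a genuine integral. *)
Lemma splice_entropy_le (p1 p2 : probability T R)
    (r : {sigma_finite_measure set T -> \bar R}) (z1 z2 phi : T -> R) (K : set T) :
  measurable K ->
  measurable_fun setT z1 -> (forall w, (0 <= z1 w)%R) ->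
  (forall A, measurable A -> p1 A = \int[r]_(w in A) (z1 w)%:E) ->
  measurable_fun setT z2 -> (forall w, (0 <= z2 w)%R) ->
  (forall A, measurable A -> p2 A = \int[r]_(w in A) (z2 w)%:E) ->
  (forall w, ~ K w -> z2 w = z1 w) ->
  p2.-integrable K (EFin \o phi) ->
  {ae p2, forall w, K w -> ln (z2 w) = phi w} ->
  relative_entropy p1 r \is a fin_num ->
  relative_entropy p1 r <= relative_entropy p2 r ->
  \int[p1]_(w in K) (ln (z1 w))%:E <= \int[p2]_(w in K) (phi w)%:E.
Proof.
move=> mK mz1 z10 p1E mz2 z20 p2E z21 iphi phiE h1_fin.
have mln (z : T -> R) : measurable_fun setT z ->
    measurable_fun setT (fun w => (ln (z w))%:E).
  by move=> mz; apply/measurable_EFinP; exact: measurableT_comp.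
have i1 := relative_entropy_fin_num mz1 z10 p1E h1_fin.
have phi_ae : ae_eq p2 K (fun w => (ln (z2 w))%:E) (EFin \o phi).
  by apply: filterS phiE => w /[apply] ->.
have mCK := measurableC mK.
have p21 A : measurable A -> A `<=` ~` K -> p2 A = p1 A.
  move=> mA AK; rewrite p2E// p1E//; apply: eq_integral => w /[!inE] Aw.
  by rewrite z21//; exact: AK.
have i2K : p2.-integrable K (fun w => (ln (z2 w))%:E).
  apply: (ae_eq_integrable _ _ (ae_eq_sym phi_ae)) => //.
  by apply: (measurable_funS measurableT) => //; exact: mln.
have i2CK : p2.-integrable (~` K) (fun w => (ln (z2 w))%:E).
  apply/integrableP; split.
    by apply: (measurable_funS measurableT) => //; exact: mln.
  rewrite (eq_measure_integral p1)//.
  under eq_integral => w /[!inE] Kw do rewrite z21//.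
  by have /integrableP[] := integrableS measurableT mCK (@subsetT _ _) i1.
have i2 := integrable_setC mK (mln _ mz2) i2K i2CK.
rewrite (relative_entropy_density mz1 z10 p1E i1).
rewrite (relative_entropy_density mz2 z20 p2E i2).
rewrite (integral_setUC _ mK (mln _ mz1)) (integral_setUC _ mK (mln _ mz2)).
have -> : \int[p2]_(w in ~` K) (ln (z2 w))%:E = \int[p1]_(w in ~` K) (ln (z1 w))%:E.
  rewrite (eq_measure_integral p1)//.
  by apply: eq_integral => w /[!inE] Kw; rewrite z21.
have fin : \int[p1]_(w in ~` K) (ln (z1 w))%:E \is a fin_num.
  by apply: integrable_fin_num => //; exact: (integrableS measurableT).
rewrite leeD2rE//; move=> /le_trans; apply; rewrite le_eqVlt; apply/orP; left.
apply/eqP; apply: ae_eq_integral => //.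
  by apply: (measurable_funS measurableT) => //; exact: mln.
by have /integrableP[] := iphi.
Qed.

End splice.

(** * Minimizers of the entropy are conditionally independent *)

Section marginal_density.
Context d dW (T : measurableType d) (W : measurableType dW) (R : realType).
Local Open Scope ereal_scope.

Lemma integral_marginal (P m : {measure set T -> \bar R}) (s : T -> W) (b : T -> R) :
  measurable_fun setT s -> measurable_fun setT b -> (forall w, (0 <= b w)%R) ->
  (forall A, measurable A -> P (s @^-1` A) = \int[m]_(w in s @^-1` A) (b w)%:E) ->
  forall a : W -> R, measurable_fun setT a -> (forall y, (0 <= a y)%R) ->
  \int[P]_w (a (s w))%:E = \int[m]_w (a (s w) * b w)%:E.
Proof.
move=> ms mb b0 Pb a ma a0.
rewrite -(eq_integral_comp_mul (m1 := P) (b1 := cst 1%R) ms _ _ mb)//.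
- by apply: eq_integral => w _; rewrite mulr1.
- move=> A mA; rewrite -Pb//.
  by rewrite -[RHS]mul1e -integral_cst//; exact: measurable_preimage.
Qed.

(** The reference measure is [e m], of mass 1, so its image under [s] is finite. It dominates: if
    [e m] vanishes on an event of [s], then [e = 0] there [m]-almost everywhere, hence [P]-almost
    everywhere, against [e > 0]. The last bound is E_P[1/zs(s)], the integral of [e] over the set
    where [zs(s) > 0]. *)
Lemma marginal_density (P : probability T R) (m : {measure set T -> \bar R})
    (e : T -> R) (s : T -> W) :
  measurable_fun setT s -> measurable_fun setT e -> (forall w, (0 <= e w)%R) ->
  P `<< m -> {ae P, forall w, (0 < e w)%R} -> \int[m]_w (e w)%:E = 1 ->
  exists zs : W -> R, [/\ measurable_fun setT zs, (forall y, (0 <= zs y)%R),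
    (forall A, measurable A ->
      P (s @^-1` A) = \int[m]_(w in s @^-1` A) (zs (s w) * e w)%:E),
    {ae P, forall w, (0 < zs (s w))%R} &
    \int[P]_w (expR (- ln (zs (s w))))%:E <= 1].
Proof.
move=> ms me e0 Pm e_gt0 e1.
pose me_ := density_measure m me e0.
have PT_fin : P setT < +oo by rewrite probability_setT ltry.
have [||zs [mzs zs0 zsE]] := exists_density_comp (m := me_) ms PT_fin.
- by apply: sigma_finite_pushforward; rewrite /me_/= /density_measure e1 ltry.
- move=> A mA; rewrite /me_/= /density_measure => eA0.
  have msA := measurable_preimage ms mA.
  have : ae_eq m (s @^-1` A) (EFin \o e) (cst 0).
    apply/ae_eq_integral_abs => //; first exact: measurable_EFinS.
    by rewrite -[RHS]eA0; apply: eq_integral => w _; rewrite gee0_abs ?lee_fin.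
  move=> /(null_dominates_ae_eq msA Pm) /(filterI e_gt0) [N [mN N0 subN]].
  apply/eqP; rewrite -measure_le0 -N0 le_measure ?inE// => w Aw; apply: subN.
  by move=> /= [] + /(_ Aw) [] ew0; rewrite ew0 ltxx.
have mzss : measurable_fun setT (zs \o s) by exact: measurableT_comp.
have zsE' A : measurable A ->
    P (s @^-1` A) = \int[m]_(w in s @^-1` A) (zs (s w) * e w)%:E.
  move=> mA; have msA := measurable_preimage ms mA.
  rewrite zsE// integral_indic_mul.
  rewrite (@integral_density _ _ _ m e me e0
    (fun w => \1_(s @^-1` A) w * zs (s w))%R)//.
  - by rewrite [RHS]integral_indic_mul; apply: eq_integral => w _; rewrite mulrA.
  - by apply: measurable_funM => //; exact: measurable_indic.
  - by move=> w; rewrite mulr_ge0.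
exists zs; split => //.
- have mN : measurable (zs @^-1` [set 0%R]) by exact: measurable_preimage.
  exists (s @^-1` (zs @^-1` [set 0%R])); split => //.
  + exact: measurable_preimage.
  + apply: etrans (zsE' _ mN) _.
    under eq_integral => w /[!inE] /= -> do rewrite mul0r.
    by rewrite integral0.
  + by move=> w /= /negP; rewrite -leNgt => zw; apply/eqP; rewrite eq_le zw zs0.
- have -> := integral_marginal (a := fun y => expR (- ln (zs y))) ms _ _ zsE' _ _.
  + rewrite -[leRHS]e1; apply: ge0_le_integral => //.
    * by move=> w _; rewrite lee_fin !mulr_ge0// expR_ge0.
    * apply/measurable_EFinP; apply: measurable_funM; last exact: measurable_funM.
      apply: measurableT_comp => //; apply: measurable_funN.
      exact: measurableT_comp.
    * exact: measurable_EFinS.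
    (* Where [zs] vanishes, the product is 0 whatever value [ln] takes at 0. *)
    * move=> w _; rewrite lee_fin mulrA ler_piMl//.
      have := zs0 (s w); rewrite le_eqVlt => /predU1P[<-|z_gt0].
        by rewrite mulr0.
      by rewrite expRN lnK ?posrE// mulVf ?gt_eqF.
  + exact: measurable_funM.
  + by move=> w; rewrite mulr_ge0.
  + apply: measurableT_comp => //; apply: measurable_funN.
    exact: measurableT_comp.
  + by move=> y; exact: expR_ge0.
Qed.

End marginal_density.

Section product_density.
Context d dU dV dE (T : measurableType d) (U : measurableType dU)
  (V : measurableType dV) (E : measurableType dE) (R : realType).
Variables (P Q : {measure set T -> \bar R}).
Variables (p : T -> U) (q : T -> V) (x : T -> E) (xU : U -> E) (xV : V -> E).
Hypotheses (mp : measurable_fun setT p) (mq : measurable_fun setT q)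
  (mxU : measurable_fun setT xU) (mxV : measurable_fun setT xV)
  (xUp : forall w, x w = xU (p w)) (xVq : forall w, x w = xV (q w)).
Hypothesis ind : cond_indep Q p q x.
Variables (e : E -> R) (zu : U -> R) (zv : V -> R).
Hypotheses (me : measurable_fun setT e) (e0 : forall y, 0 <= e y).
Hypotheses (mzu : measurable_fun setT zu) (zu0 : forall u, 0 <= zu u).
Hypotheses (mzv : measurable_fun setT zv) (zv0 : forall v, 0 <= zv v).
Local Open Scope ereal_scope.
Hypothesis eE : forall C, measurable C ->
  P (x @^-1` C) = \int[Q]_(w in x @^-1` C) (e (x w))%:E.
Hypothesis zuE : forall A, measurable A ->
  P (p @^-1` A) = \int[Q]_(w in p @^-1` A) (zu (p w) * e (x w))%:E.
Hypothesis zvE : forall B, measurable B ->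
  P (q @^-1` B) = \int[Q]_(w in q @^-1` B) (zv (q w) * e (x w))%:E.

Let mx : measurable_fun setT x.
Proof.
by rewrite (_ : x = xV \o q); [exact: measurableT_comp|exact/funext].
Qed.

Let mex : measurable_fun setT (e \o x).
Proof. exact: measurableT_comp. Qed.

Let mzup : measurable_fun setT (zu \o p).
Proof. exact: measurableT_comp. Qed.

Let mexV : measurable_fun setT (e \o xV).
Proof. exact: measurableT_comp. Qed.

(** [g(x)] is the conditional probability under [P] of the event [B] of [q]. With [B = setT] and
    [g = 1], the identity says that [z' Q] gives [p] the same law as [P]; for general [B], that
    given [p] the event has probability [g(x)] under [z' Q], which is conditional independence. *)
Lemma integral_product_density (a : U -> R) (B : set V) (g : E -> R) :
  measurable_fun setT a -> (forall u, (0 <= a u)%R) ->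
  measurable B -> measurable_fun setT g -> (forall y, (0 <= g y)%R) ->
  (forall C, measurable C -> \int[P]_(w in x @^-1` C) (g (x w))%:E =
    P (q @^-1` B `&` x @^-1` C)) ->
  \int[Q]_w (a (p w) * \1_B (q w) * (zu (p w) * zv (q w) * e (x w)))%:E =
  \int[P]_w (a (p w) * g (x w))%:E.
Proof.
move=> ma a0 mB mg g0 gE.
have mgxU : measurable_fun setT (g \o xU) by exact: measurableT_comp.
have mindC (C : set E) : measurable C -> measurable_fun setT (\1_C : E -> R).
  by move=> mC; exact: measurable_indic.
transitivity (\int[Q]_w
    ((a (p w) * zu (p w)) * (\1_B (q w) * zv (q w) * e (xV (q w))))%:E).
  by apply: eq_integral => w _; rewrite -xVq; congr (_%:E); ring.
rewrite (cond_indep_integral mp mq mx ind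
  (b := fun v => (\1_B v * zv v * e (xV v))%R)
  (e := fun y => (g y * e y)%R) _ _ _ _ _ (a := fun u => (a u * zu u)%R)).
- transitivity (\int[P]_w (a (p w) * g (xU (p w)))%:E); last first.
    by apply: eq_integral => w _; rewrite xUp.
  rewrite (integral_marginal (m := Q) (b := fun w => (zu (p w) * e (x w))%R)
    (a := fun u => (a u * g (xU u))%R) mp _ _ zuE)//.
  + apply: eq_integral => w _; congr (_%:E); rewrite -xUp; ring.
  + exact: measurable_funM.
  + by move=> w; rewrite mulr_ge0.
  + exact: measurable_funM.
  + by move=> u; rewrite mulr_ge0.
- by apply: measurable_funM => //; exact: measurable_funM.
- by move=> v; rewrite !mulr_ge0.
- exact: measurable_funM.
- by move=> y; rewrite mulr_ge0.
(* [g e] is the conditional expectation of [1_B zv e] given [x] under [Q]: over an event of [x],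
   both integrate to the probability under [P] of its intersection with the event of [q]. *)
- move=> C mC; transitivity (P (q @^-1` (B `&` xV @^-1` C))).
    rewrite zvE; last by apply: measurableI => //; exact: measurable_preimage.
    rewrite [LHS]integral_indic_mul [RHS]integral_indic_mul.
    apply: eq_integral => w _; congr (_%:E); rewrite -xVq !mulrA.
    congr (_ * _ * _)%R.
    by rewrite !indic_preimage indicI/= indic_preimage -xVq mulrC.
  have -> : q @^-1` (B `&` xV @^-1` C) = q @^-1` B `&` x @^-1` C.
    by apply/seteqP; split => w /=; rewrite xVq.
  rewrite -gE// [LHS]integral_indic_mul [RHS]integral_indic_mul.
  transitivity (\int[P]_w (\1_C (x w) * g (x w))%:E).
    by apply: eq_integral => w _; rewrite indic_preimage.
  rewrite (integral_marginal (m := Q) (b := e \o x)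
    (a := fun y => (\1_C y * g y)%R) mx _ _ eE)//.
  + by apply: eq_integral => w _; congr (_%:E); rewrite !mulrA.
  + by move=> w /=.
  + by apply: measurable_funM => //; exact: mindC.
  + by move=> y; rewrite mulr_ge0.
- exact: measurable_funM.
- by move=> u; rewrite mulr_ge0.
Qed.

End product_density.

Section entropy_minimizer.
Context d dU dV dE (T : measurableType d) (U : measurableType dU)
  (V : measurableType dV) (E : measurableType dE) (R : realType).
Variables (P : probability T R) (Q : {sigma_finite_measure set T -> \bar R}).
Variables (p : T -> U) (q : T -> V) (x : T -> E) (xU : U -> E) (xV : V -> E).
Hypotheses (mp : measurable_fun setT p) (mq : measurable_fun setT q)
  (mxU : measurable_fun setT xU) (mxV : measurable_fun setT xV)
  (xUp : forall w, x w = xU (p w)) (xVq : forall w, x w = xV (q w)).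
Hypothesis x_sfin : sigma_finite setT (pushforward Q x).
Hypothesis Qind : cond_indep Q p q x.
Local Open Scope ereal_scope.
Hypothesis P_fin : relative_entropy P Q \is a fin_num.
Hypothesis P_min : forall P' : probability T R,
  (forall A, measurable A -> P' (p @^-1` A) = P (p @^-1` A)) ->
  (forall B, measurable B -> P' (q @^-1` B) = P (q @^-1` B)) ->
  relative_entropy P Q <= relative_entropy P' Q.

Let mx : measurable_fun setT x.
Proof.
by rewrite (_ : x = xV \o q); [exact: measurableT_comp|exact/funext].
Qed.

Let PQ : P `<< Q. Proof. exact: relative_entropy_null_dominates. Qed.

Let Qind_sym : cond_indep Q q p x.
Proof. exact: cond_indep_sym. Qed.

Section densities.
Variables (z : T -> R) (e : E -> R) (zu : U -> R) (zv : V -> R).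
Hypotheses (mz : measurable_fun setT z) (z0 : forall w, (0 <= z w)%R).
Hypotheses (me : measurable_fun setT e) (e0 : forall y, (0 <= e y)%R).
Hypotheses (mzu : measurable_fun setT zu) (zu0 : forall u, (0 <= zu u)%R).
Hypotheses (mzv : measurable_fun setT zv) (zv0 : forall v, (0 <= zv v)%R).
Hypothesis zE : forall A, measurable A -> P A = \int[Q]_(w in A) (z w)%:E.
Hypothesis eE : forall C, measurable C ->
  P (x @^-1` C) = \int[Q]_(w in x @^-1` C) (e (x w))%:E.
Hypothesis zuE : forall A, measurable A ->
  P (p @^-1` A) = \int[Q]_(w in p @^-1` A) (zu (p w) * e (x w))%:E.
Hypothesis zvE : forall B, measurable B ->
  P (q @^-1` B) = \int[Q]_(w in q @^-1` B) (zv (q w) * e (x w))%:E.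
Hypotheses (e_gt0 : {ae P, forall w, (0 < e (x w))%R})
  (zu_gt0 : {ae P, forall w, (0 < zu (p w))%R})
  (zv_gt0 : {ae P, forall w, (0 < zv (q w))%R}).
Hypotheses (zu_int : \int[P]_w (expR (- ln (zu (p w))))%:E <= 1)
  (zv_int : \int[P]_w (expR (- ln (zv (q w))))%:E <= 1).

Definition product_density w := (zu (p w) * zv (q w) * e (x w))%R.
Local Notation z' := product_density.

Let mex : measurable_fun setT (e \o x).
Proof. exact: measurableT_comp. Qed.

Let mzup : measurable_fun setT (zu \o p).
Proof. exact: measurableT_comp. Qed.

Let mzvq : measurable_fun setT (zv \o q).
Proof. exact: measurableT_comp. Qed.

Let mz' : measurable_fun setT z'.
Proof. by apply: measurable_funM => //; exact: measurable_funM. Qed.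

Let z'0 w : (0 <= z' w)%R.
Proof. by rewrite !mulr_ge0. Qed.

Let product_density_gt0 w : (0 < z' w)%R ->
  (0 < zu (p w))%R /\ (0 < zv (q w))%R.
Proof.
move=> z'w; split; rewrite lt_neqAle ?zu0 ?zv0 andbT.
  by apply: contraTneq z'w => zw0; rewrite /product_density -zw0 !mul0r ltxx.
by apply: contraTneq z'w => zw0; rewrite /product_density -zw0 mulr0 mul0r ltxx.
Qed.

Let integral_z'_past (a : U -> R) : measurable_fun setT a ->
  (forall u, (0 <= a u)%R) ->
  \int[Q]_w (a (p w) * z' w)%:E = \int[P]_w (a (p w))%:E.
Proof.
move=> ma a0; transitivity (\int[Q]_w
    (a (p w) * \1_setT (q w) * (zu (p w) * zv (q w) * e (x w)))%:E).
  by apply: eq_integral => w _; rewrite indicT mulr1.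
rewrite (integral_product_density mp mq mxU mxV xUp xVq Qind
  me e0 mzu zu0 mzv zv0 eE zuE zvE ma a0 measurableT (g := cst 1%R))//.
  by apply: eq_integral => w _; rewrite /= mulr1.
move=> C mC; rewrite preimage_setT setTI -[RHS]mul1e -integral_cst//.
exact: measurable_preimage.
Qed.

Let integral_z'_future (b : V -> R) : measurable_fun setT b ->
  (forall v, (0 <= b v)%R) ->
  \int[Q]_w (b (q w) * z' w)%:E = \int[P]_w (b (q w))%:E.
Proof.
move=> mb b0; transitivity (\int[Q]_w
    (b (q w) * \1_setT (p w) * (zv (q w) * zu (p w) * e (x w)))%:E).
  by apply: eq_integral => w _; rewrite indicT mulr1 [(zv _ * _)%R]mulrC.
rewrite (integral_product_density mq mp mxV mxU xVq xUp Qind_sym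
  me e0 mzv zv0 mzu zu0 eE zvE zuE mb b0 measurableT (g := cst 1%R))//.
  by apply: eq_integral => w _; rewrite /= mulr1.
move=> C mC; rewrite preimage_setT setTI -[RHS]mul1e -integral_cst//.
exact: measurable_preimage.
Qed.

Section localization.
Variable n : nat.

(** The successor keeps both bounds positive at [n = 0]; as [n] varies, these sets exhaust the
    region where [e > 0]. *)
Let KE : set E := [set y | (n.+1%:R^-1 <= e y <= n.+1%:R)%R].
Let K := x @^-1` KE.

Let mKE : measurable KE.
Proof.
rewrite (_ : KE = e @^-1` [set` `[n.+1%:R^-1%R, n.+1%:R%R : R]]).
  exact: measurable_preimage.
by apply/seteqP; split => y /=; rewrite in_itv.
Qed.

Let mK : measurable K. Proof. exact: measurable_preimage. Qed.

Let mCK : measurable (~` K). Proof. exact: measurableC. Qed.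

Let Ke w : K w -> (0 < e (x w))%R.
Proof. by move=> /andP[+ _]; apply: lt_le_trans; rewrite invr_gt0. Qed.

Let z2 w := (\1_K w * z' w + \1_(~` K) w * z w)%R.

Let z2K w : K w -> z2 w = z' w.
Proof.
by move=> Kw; rewrite /z2 !indicE mem_set// memNset ?mul0r ?addr0 ?mul1r//; exact.
Qed.

Let z2CK w : ~ K w -> z2 w = z w.
Proof. by move=> Kw; rewrite /z2 !indicE memNset// mem_set ?mul0r ?add0r ?mul1r. Qed.

Let mz2 : measurable_fun setT z2.
Proof.
by apply: measurable_funD; apply: measurable_funM => //; exact: measurable_indic.
Qed.

Let z20 w : (0 <= z2 w)%R.
Proof. by rewrite addr_ge0// mulr_ge0. Qed.

(* Splicing at time t does not alter the law of the past, nor that of the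
   future, because K is X_t-measurable. *)
Let splice_law dW (W : measurableType dW) (s : T -> W) (xs : W -> E) :
  measurable_fun setT s -> measurable_fun setT xs -> (forall w, x w = xs (s w)) ->
  (forall a : W -> R, measurable_fun setT a -> (forall y, (0 <= a y)%R) ->
    \int[Q]_w (a (s w) * z' w)%:E = \int[P]_w (a (s w))%:E) ->
  forall A, measurable A -> \int[Q]_(w in s @^-1` A) (z2 w)%:E = P (s @^-1` A).
Proof.
move=> ms mxs xss sE A mA.
have msA := measurable_preimage ms mA.
have mAK : measurable (s @^-1` A `&` ~` K) by exact: measurableI.
rewrite integral_indic_mul.
transitivity (\int[Q]_w (\1_(A `&` xs @^-1` KE) (s w) * z' w)%:E +
              \int[Q]_w (\1_(s @^-1` A `&` ~` K) w * z w)%:E).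
  rewrite -ge0_integralD//.
  - apply: eq_integral => w _; rewrite -EFinD; congr (_%:E).
    rewrite /z2 mulrDr !mulrA; congr (_ * _ + _ * _)%R.
      by rewrite /K !indicI/= !indic_preimage xss.
    by rewrite indicI.
  - by move=> w _; rewrite lee_fin mulr_ge0.
  - apply/measurable_EFinP; apply: measurable_funM => //.
    rewrite (_ : (fun w => _) = \1_(s @^-1` (A `&` xs @^-1` KE))).
      apply: measurable_indic; apply: measurable_preimage => //.
      by apply: measurableI => //; exact: measurable_preimage.
    by apply/funext => w; rewrite indic_preimage.
  - by move=> w _; rewrite lee_fin mulr_ge0.
  - by apply/measurable_EFinP; apply: measurable_funM => //; exact: measurable_indic.
rewrite sE//; last first.
  by apply: measurable_indic; apply: measurableI => //; exact: measurable_preimage.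
rewrite -integral_indic_mul -zE//.
under eq_integral do rewrite -indic_preimage.
rewrite integral_indic ?setIT//; last first.
  apply: measurable_preimage => //.
  by apply: measurableI => //; exact: measurable_preimage.
rewrite (_ : s @^-1` (A `&` xs @^-1` KE) = s @^-1` A `&` K); last first.
  by apply/seteqP; split => w /=; rewrite /K /= xss.
rewrite -measureU//.
- by rewrite -setIUr setUv setIT.
- exact: measurableI.
- by rewrite setIACA setICr setI0.
Qed.

(** [gibbs_equality] is applied to [z] and the three factors of [z']. Minimality against the spliced
    measure [P2] bounds the integral of [ln z] under [P] by that of [ln z'] under [P2]. Once split
    into three terms, each a function of [p] or of [q] alone, the latter is the same under [P] and
    [P2]. *)
Lemma ln_density_splice :
  {ae P, forall w, K w ->
    ln (z w) = (ln (e (x w)) + ln (zu (p w)) + ln (zv (q w)))%R}.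
Proof.
have z_gt0 := density_ae_gt0 mz z0 zE.
have mlz : measurable_fun setT (fun w => ln (z w)) by exact: measurableT_comp.
have mle : measurable_fun setT (fun w => ln (e (x w))) by exact: measurableT_comp.
have mlu : measurable_fun setT (fun w => ln (zu (p w))) by exact: measurableT_comp.
have mlv : measurable_fun setT (fun w => ln (zv (q w))) by exact: measurableT_comp.
have f1 : density_measure Q mz2 z20 setT = 1.
  have := splice_law mp mxU xUp integral_z'_past measurableT.
  by rewrite preimage_setT probability_setT.
pose P2 : probability T R := density_probability f1.
have P2E A : P2 A = \int[Q]_(w in A) (z2 w)%:E by [].
have P2p A : measurable A -> P2 (p @^-1` A) = P (p @^-1` A).
  by move=> mA; exact: (splice_law mp mxU xUp integral_z'_past).
have P2q B : measurable B -> P2 (q @^-1` B) = P (q @^-1` B).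
  by move=> mB; exact: (splice_law mq mxV xVq integral_z'_future).
have ln_bound w : K w -> (`|ln (e (x w))| <= ln n.+1%:R)%R.
  move=> Kw; have ew := Ke Kw; move: Kw => /andP[ne en].
  rewrite ler_norml; apply/andP; split; last by rewrite ler_ln ?posrE.
  by rewrite -lnV ?posrE// ler_ln ?posrE ?invr_gt0.
have ile : P.-integrable K (EFin \o (fun w => ln (e (x w)))).
  apply: (le_integrable_EFin (g := cst (ln n.+1%:R))) => //.
  exact: finite_measure_integrable_cst.
apply: gibbs_equality => //.
- exact: integrableS (relative_entropy_fin_num mz z0 zE P_fin).
- apply: (@le_lt_trans _ _ 1); last exact: ltry.
  apply: le_trans zu_int; apply: ge0_subset_integral => //.
  by apply/measurable_EFinP; apply: measurableT_comp => //; exact: measurable_funN.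
- apply: (@le_lt_trans _ _ 1); last exact: ltry.
  apply: le_trans zv_int; apply: ge0_subset_integral => //.
  by apply/measurable_EFinP; apply: measurableT_comp => //; exact: measurable_funN.
- pose G w := expR (ln (e (x w)) + ln (zu (p w)) + ln (zv (q w)) - ln (z w))%R.
  rewrite -/(G _).
  have mG : measurable_fun setT G.
    apply: measurableT_comp => //; apply: measurable_funB => //.
    by apply: measurable_funD => //; exact: measurable_funD.
  (* [expR] inverts [ln] only at positive arguments, so [K] is cut down to where [z' > 0], at no
     cost under [P]. There [G z] is [z'], or 0 where [z = 0], so the integral is at most that of
     [z'] over [K] under [Q], which is [P K]. *)
  pose K' := K `&` z' @^-1` [set` `](0%R : R), +oo[].
  have mK' : measurable K' by apply: measurableI => //; exact: measurable_preimage.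
  have mK'G : measurable_fun setT (fun w => \1_K' w * G w)%R.
    by apply: measurable_funM => //; exact: measurable_indic.
  have K'G0 w : (0 <= \1_K' w * G w)%R by rewrite mulr_ge0// expR_ge0.
  have K'P w : K' w -> K w /\ (0 < z' w)%R.
    by move=> [Kw] /=; rewrite in_itv/= andbT.
  have -> : \int[P]_(w in K) (G w)%:E = \int[P]_w (\1_K' w * G w)%:E.
    rewrite integral_indic_mul; apply: ge0_ae_eq_integral => //.
    + apply/measurable_EFinP; apply: measurable_funM => //; exact: measurable_indic.
    + by apply/measurable_EFinP.
    + by move=> w _; rewrite lee_fin mulr_ge0// expR_ge0.
    + by move=> w _; rewrite lee_fin.
    + apply: filterS (filterI e_gt0 (filterI zu_gt0 zv_gt0)) => w [ew [uw vw]] _.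
      congr (_ * _)%:E.
      rewrite /K' indicI/= [X in (_ * X)%R](_ : _ = 1%R) ?mulr1//.
      by rewrite indicE mem_set//= in_itv/= andbT !mulr_gt0.
  rewrite (integral_marginal (s := idfun) (m := Q) _ mz z0 zE
    (a := fun w => \1_K' w * G w)%R)//;
    last exact: measurable_id.
  have KU : K = p @^-1` (xU @^-1` KE) by apply/seteqP; split => w; rewrite /K/= xUp.
  have mKU : measurable (xU @^-1` KE) by exact: measurable_preimage.
  have PKE : \int[P]_w (\1_(xU @^-1` KE) (p w))%:E = P K.
    under eq_integral do rewrite -(indic_preimage _ p) -KU.
    by rewrite integral_indic// setIT.
  rewrite -PKE -(integral_z'_past (a := \1_(xU @^-1` KE)))//.
  apply: ge0_le_integral => //.
  + by move=> w _; rewrite lee_fin mulr_ge0.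
  + by apply/measurable_EFinP; exact: measurable_funM.
  + apply/measurable_EFinP; apply: measurable_funM => //.
    under eq_fun do rewrite -(indic_preimage _ p) -KU.
    exact: measurable_indic.
  + move=> w _; rewrite lee_fin -(indic_preimage _ p) -KU.
    have [K'w|K'w] := pselect (K' w); last first.
      by rewrite [\1_K' w]indicE memNset// !mul0r mulr_ge0.
    have [Kw z'w] := K'P _ K'w.
    rewrite !indicE !mem_set// !mul1r.
    have := z0 w; rewrite le_eqVlt => /predU1P[<-|zw]; first by rewrite mulr0.
    have ew := Ke Kw.
    have [uw vw] := product_density_gt0 z'w.
    rewrite /G expRD !expRD expRN !lnK ?posrE// -mulrA mulVf ?gt_eqF// mulr1.
    by rewrite /product_density [leRHS]mulrC mulrA lexx.
move=> ilu ilv.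
have mKU : measurable (xU @^-1` KE) by exact: measurable_preimage.
have mKV : measurable (xV @^-1` KE) by exact: measurable_preimage.
have KU : K = p @^-1` (xU @^-1` KE) by apply/seteqP; split => w; rewrite /K/= xUp.
have KV : K = q @^-1` (xV @^-1` KE) by apply/seteqP; split => w; rewrite /K/= xVq.
have P2p' A : measurable A -> P (p @^-1` A) = P2 (p @^-1` A).
  by move=> mA; exact/esym/P2p.
have P2q' B : measurable B -> P (q @^-1` B) = P2 (q @^-1` B).
  by move=> mB; exact/esym/P2q.
have law_p (h : U -> R) : measurable_fun setT h ->
    P.-integrable K (EFin \o (h \o p)) ->
    P2.-integrable K (EFin \o (h \o p)) /\
    \int[P]_(w in K) (h (p w))%:E = \int[P2]_(w in K) (h (p w))%:E.
  move=> mh; rewrite KU => ih; split.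
    exact: (same_law_integrable mp P2p' mKU mh ih).
  exact: (same_law_integral mp P2p' mKU mh ih).
have law_q (h : V -> R) : measurable_fun setT h ->
    P.-integrable K (EFin \o (h \o q)) ->
    P2.-integrable K (EFin \o (h \o q)) /\
    \int[P]_(w in K) (h (q w))%:E = \int[P2]_(w in K) (h (q w))%:E.
  move=> mh; rewrite KV => ih; split.
    exact: (same_law_integrable mq P2q' mKV mh ih).
  exact: (same_law_integral mq P2q' mKV mh ih).
have mln dW (W : measurableType dW) (f : W -> R) :
    measurable_fun setT f -> measurable_fun setT (fun u => ln (f u)).
  by move=> mf; exact: measurableT_comp.
have [i2u intu] := law_p _ (mln _ _ _ mzu) ilu.
have [i2v intv] := law_q _ (mln _ _ _ mzv) ilv.
have mexU : measurable_fun setT (e \o xU) by exact: measurableT_comp.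
(* Read through [xU], this term becomes a function of [p], and equality of the laws of [p] applies
   to it. *)
have lnex : (fun w => ln (e (x w))) = (fun w => ln (e (xU (p w)))).
  by apply/funext => w; rewrite xUp.
have [i2e inte] : P2.-integrable K (EFin \o (fun w => ln (e (x w)))) /\
    \int[P]_(w in K) (ln (e (x w)))%:E = \int[P2]_(w in K) (ln (e (x w)))%:E.
  have ilex := ile; rewrite lnex in ilex.
  have [i2e inte] := law_p _ (mln _ _ _ mexU) ilex.
  rewrite lnex; split => //.
  under eq_integral do rewrite xUp.
  by under [RHS]eq_integral do rewrite xUp.
have iD (m : {measure set T -> \bar R}) (f h : T -> R) :
    m.-integrable K (EFin \o f) -> m.-integrable K (EFin \o h) ->
    m.-integrable K (EFin \o (fun w => f w + h w)%R).
  by move=> fi hi; exact: (integrableD mK fi hi).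
have intD (m : {measure set T -> \bar R}) (f g h : T -> R) :
    m.-integrable K (EFin \o f) -> m.-integrable K (EFin \o g) ->
    m.-integrable K (EFin \o h) ->
    \int[m]_(w in K) (f w + g w + h w)%:E = \int[m]_(w in K) (f w)%:E +
      \int[m]_(w in K) (g w)%:E + \int[m]_(w in K) (h w)%:E.
  move=> fi gi hi; rewrite (integralD_EFin mK (iD _ _ _ fi gi) hi).
  by rewrite (integralD_EFin mK fi gi).
rewrite (intD P _ _ _ ile ilu ilv) inte intu intv -(intD P2 _ _ _ i2e i2u i2v).
apply: (splice_entropy_le mK mz z0 zE mz2 z20 (fun A _ => P2E A) z2CK) => //.
- exact: (iD P2 _ _ (iD P2 _ _ i2e i2u) i2v).
(* [P2] does not charge the zeros of [z2]; elsewhere on [K] all factors of [z'] are positive and the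
   logarithm splits. *)
- apply: filterS (density_ae_gt0 mz2 z20 (fun A _ => P2E A)) => w + Kw.
  rewrite (z2K Kw) => z'w; have ew := Ke Kw.
  have [uw vw] := product_density_gt0 z'w.
  rewrite /product_density lnM ?posrE ?mulr_gt0// lnM ?posrE//.
  by rewrite addrC addrA.
- exact: P_min.
Qed.

End localization.
Lemma product_density_ae : {ae P, forall w, z w = z' w}.
Proof.
have z_gt0 := density_ae_gt0 mz z0 zE.
have lnz_ae := ae_foralln ln_density_splice.
apply: filterS (filterI (filterI z_gt0 e_gt0)
  (filterI (filterI zu_gt0 zv_gt0) lnz_ae)) => w [[zw ew] [[uw vw] lnzE]].
have [n [ne en]] : exists n, (n.+1%:R^-1 <= e (x w))%R /\ (e (x w) <= n.+1%:R)%R.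
  (* An integer above the sum of [e] and its inverse serves both bounds at once. *)
  pose y := (e (x w) + (e (x w))^-1)%R.
  have y0 : (0 <= y)%R by rewrite addr_ge0// ?invr_ge0 ltW.
  have yn : (y <= (Num.bound y).+1%:R)%R.
    by rewrite ltW// (lt_trans (archi_boundP y0))// ltr_nat.
  exists (Num.bound y); split.
    rewrite invf_ple ?posrE//; apply: le_trans yn.
    by rewrite /y lerDr ltW.
  by apply: le_trans yn; rewrite /y lerDl invr_ge0 ltW.
have z'w : (0 < z' w)%R by rewrite /product_density !mulr_gt0.
apply: ln_inj; rewrite ?posrE//.
have -> := lnzE n; last by rewrite /= ne en.
rewrite /product_density lnM ?posrE ?mulr_gt0// lnM ?posrE//.
by rewrite -addrA addrC.
Qed.

(** Since [z = z'] only [P]-almost everywhere, [z'] could a priori be positive where [z = 0], and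
    one obtains just [P D <= (z' Q) D] for every [D]. Both measures have mass 1, so this inequality
    on the complement of [A] gives the converse on [A]. *)
Lemma product_densityE (A : set T) : measurable A ->
  P A = \int[Q]_(w in A) (z' w)%:E.
Proof.
have z'T : \int[Q]_w (z' w)%:E = 1.
  transitivity (\int[P]_w (cst 1%R (p w))%:E).
    rewrite -(integral_z'_past (a := cst 1%R))//.
    by apply: eq_integral => w _; rewrite /= mul1r.
  by rewrite -[RHS](probability_setT P) -[RHS]mul1e -integral_cst.
have le_z' (D : set T) : measurable D -> P D <= \int[Q]_(w in D) (z' w)%:E.
  move=> mD; have [N [mN PN0 subN]] := product_density_ae.
  have mDN : measurable (D `\` N) by exact: measurableD.
  have -> : P D = P (D `\` N).
    apply/eqP; rewrite eq_le; apply/andP; split; last first.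
      by apply: le_measure; rewrite ?inE.
    apply: (@le_trans _ _ (P (D `\` N) + P N)); last by rewrite PN0 adde0.
    apply: (@le_trans _ _ (P ((D `\` N) `|` N))).
      apply: le_measure; rewrite ?inE//; first exact: measurableU.
      by move=> w Dw; have [Nw|Nw] := pselect (N w); [right|left].
    exact: measureU2.
  rewrite zE// (_ : \int[Q]_(w in _) _ = \int[Q]_(w in D `\` N) (z' w)%:E).
    apply: ge0_subset_integral => //; first exact: measurable_EFinS.
    by move=> w _; rewrite lee_fin.
  apply: eq_integral => w /[!inE] -[_ Nw]; congr (_%:E).
  by apply: contrapT => /subN.
move=> mA; have mCA := measurableC mA.
apply/eqP; rewrite eq_le le_z'//=.
have PCA_fin : P (~` A) \is a fin_num by exact: fin_num_measure.
rewrite -(leeD2rE _ _ PCA_fin) -measureU// ?setUv ?setICr//.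
rewrite [leRHS](_ : _ = 1); last exact: probability_setT.
rewrite -z'T -(setUv A) ge0_integral_setU//.
- by rewrite leeD2l// le_z'.
- by rewrite setUv; exact: measurable_EFinS.
- by move=> w _; rewrite lee_fin.
- by rewrite disj_set2E setICr.
Qed.

(** Under [P], [f(x)] is exchanged for the indicator of the event of [p], which absorbs the event of
    [x]. [integral_product_density] then turns [g(x)] into the event of [q] under [z' Q], which is
    [P]. *)
Lemma product_density_cond_indep (A : set U) (B : set V) :
  measurable A -> measurable B -> exists f g : E -> R,
  [/\ cond_prob P x (p @^-1` A) f, cond_prob P x (q @^-1` B) g &
      cond_prob P x (p @^-1` A `&` q @^-1` B) (fun y => f y * g y)%R].
Proof.
move=> mA mB.
have mpA := measurable_preimage mp mA; have mqB := measurable_preimage mq mB.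
have [f Af] := cond_prob_exists P mx mpA.
have [g Bg] := cond_prob_exists P mx mqB.
exists f, g; split => //.
have [mf f01 fE] := Af; have [mg g01 gE] := Bg.
have f0 y : (0 <= f y)%R by have /andP[] := f01 y.
have g0 y : (0 <= g y)%R by have /andP[] := g01 y.
split.
- exact: measurable_funM.
- move=> y; have /andP[_ f1] := f01 y; have /andP[_ g1] := g01 y.
  by rewrite mulr_ge0//= mulr_ile1.
move=> C mC; have mxC := measurable_preimage mx mC.
have mxUC := measurable_preimage mxU mC.
transitivity (\int[P]_w ((\1_C (x w) * g (x w)) * f (x w))%:E).
  rewrite integral_indic_mul; apply: eq_integral => w _; congr (_%:E).
  by rewrite indic_preimage -mulrA [(f _ * _)%R]mulrC.
rewrite (cond_prob_integral mx mpA Af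
  (c := fun y => \1_C y * g y)%R)//; last 2 first.
- by apply: measurable_funM => //; exact: measurable_indic.
- by move=> y; rewrite mulr_ge0.
transitivity (\int[P]_w (\1_(A `&` xU @^-1` C) (p w) * g (x w))%:E).
  apply: eq_integral => w _; congr (_%:E).
  rewrite indicI/= !(indic_preimage _ p) !(indic_preimage _ xU) -xUp; ring.
rewrite -(integral_product_density mp mq mxU mxV xUp xVq Qind
  me e0 mzu zu0 mzv zv0 eE zuE zvE
  (a := \1_(A `&` xU @^-1` C)) _ _ mB mg g0)//; last first.
  by apply: measurable_indic; exact: measurableI.
apply: etrans (esym (product_densityE _)); last first.
  by apply: measurableI => //; exact: measurableI.
rewrite [RHS]integral_indic_mul; apply: eq_integral => w _; congr (_ * _)%:E.
rewrite !indicI/= !(indic_preimage _ p) !(indic_preimage _ q) (indic_preimage _ xU).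
by rewrite (indic_preimage _ x) -xUp mulrAC.
Qed.

End densities.

Lemma entropy_minimizer_cond_indep (A : set U) (B : set V) :
  measurable A -> measurable B -> exists f g : E -> R,
  [/\ cond_prob P x (p @^-1` A) f, cond_prob P x (q @^-1` B) g &
      cond_prob P x (p @^-1` A `&` q @^-1` B) (fun y => f y * g y)%R].
Proof.
have PT_fin : P setT < +oo by rewrite probability_setT ltry.
have [z [mz z0 zE]] := exists_density PQ.
have [|e [me e0 eE]] := exists_density_comp mx PT_fin x_sfin.
  move=> C mC; have /null_content_dominatesP := PQ; apply.
  exact: measurable_preimage.
have mex : measurable_fun setT (e \o x) by exact: measurableT_comp.
have ex0 w : (0 <= (e \o x) w)%R by exact: e0.
have e_gt0 : {ae P, forall w, (0 < (e \o x) w)%R}.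
  have mN : measurable (e @^-1` [set 0%R]) by exact: measurable_preimage.
  exists (x @^-1` (e @^-1` [set 0%R])); split.
  - exact: measurable_preimage.
  - apply: etrans (eE _ mN) _.
    under eq_integral => w /[!inE] /= -> do [].
    by rewrite integral0.
  - by move=> w /= /negP; rewrite -leNgt => ew; apply/eqP; rewrite eq_le ew e0.
have e1 : \int[Q]_w ((e \o x) w)%:E = 1.
  by rewrite -(probability_setT P); have := eE _ measurableT; rewrite preimage_setT.
have [zu [mzu zu0 zuE zu_gt0 zu_int]] := marginal_density mp mex ex0 PQ e_gt0 e1.
have [zv [mzv zv0 zvE zv_gt0 zv_int]] := marginal_density mq mex ex0 PQ e_gt0 e1.
exact: (product_density_cond_indep mz z0 me e0 mzu zu0 mzv zv0).
Qed.

End entropy_minimizer.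

(** * Markov path measures *)

Section sigma_finite_cond_prob.
Context d dE dF (T : measurableType d) (E : measurableType dE)
  (F : measurableType dF) (R : realType) (m : {measure set T -> \bar R}).
Local Open Scope ereal_scope.

(* If f n is a version of m(y \in K n | x), the sets {f n > 1/(k+1)} have finite
   mass, and they miss only a set on which every f n vanishes. *)
Lemma sigma_finite_cond_prob (x : T -> E) (y : T -> F) :
  measurable_fun setT x -> measurable_fun setT y ->
  sigma_finite setT (pushforward m y) ->
  (forall C, measurable C -> exists f, cond_prob m x (y @^-1` C) f) ->
  sigma_finite setT (pushforward m x).
Proof.
move=> mx my [K KT mK] cpK.
have /choice[f fK] n : exists f, cond_prob m x (y @^-1` (K n)) f.
  by apply: cpK; have [] := mK n.
have f0 n v : (0 <= f n v)%R by have [_ /(_ v)/andP[]] := fK n.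
have mf n : measurable_fun setT (f n) by have [] := fK n.
have mxC C : measurable C -> measurable (x @^-1` C) by exact: measurable_preimage.
have myC C : measurable C -> measurable (y @^-1` C) by exact: measurable_preimage.
pose D (ij : nat * nat) := f ij.1 @^-1` [set` `](ij.2.+1%:R^-1 : R)%R, +oo[].
pose N : set E := ~` \bigcup_n \bigcup_k D (n, k).
have mD ij : measurable (D ij) by exact: measurable_preimage.
have mN : measurable N.
  apply: measurableC; apply: bigcupT_measurable => n.
  by apply: bigcupT_measurable => k.
(* A sequence enumerating the countable family of all [D ij], with the null set [N] added as the
   piece [None]. *)
pose G (i : nat) : set E :=
  match unpickle i : option (option (nat * nat)) with
  | Some (Some ij) => D ij
  | Some None => N
  | None => set0
  end.
have DP ij v : D ij v -> (ij.2.+1%:R^-1 < f ij.1 v)%R.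
  by rewrite /D/= in_itv/= andbT.
have fN n v : N v -> f n v = 0%R.
  move=> Nv; apply/eqP; rewrite eq_le f0 andbT leNgt; apply/negP => fv0.
  apply: Nv; exists n => //; exists (Num.bound (f n v)^-1) => //.
  rewrite /D/= in_itv/= andbT invf_plt ?posrE//.
  have fV0 : (0 <= (f n v)^-1)%R by rewrite invr_ge0.
  by rewrite (lt_trans (archi_boundP fV0))// ltr_nat.
have mN0 : m (x @^-1` N) = 0.
  apply: measure_negligible; first exact: mxC.
  rewrite (_ : x @^-1` N = \bigcup_n (y @^-1` (K n) `&` x @^-1` N)).
    apply: negligible_bigcup => n; apply/negligibleP.
      by apply: measurableI; [apply: myC; have [] := mK n|exact: mxC].
    have [_ _ fE] := fK n; apply: etrans (esym (fE N mN)) _.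
    by under eq_integral => w /[!inE] /= Nw do rewrite fN//; rewrite integral0.
  rewrite -setI_bigcupl; apply/seteqP; split => [w Nw|w []//]; split => //.
  have : setT (y w) by [].
  by rewrite KT => -[n _ Knw]; exists n.
have mDlty ij : m (x @^-1` (D ij)) < +oo.
  have [mKn Kn_fin] := mK ij.1.
  (* Markov's inequality: [f] exceeds this constant on [D ij], and its integral there is at most the
     finite mass of [K ij.1]. *)
  have : (ij.2.+1%:R^-1)%:E * m (x @^-1` (D ij)) <= m (y @^-1` (K ij.1)).
    rewrite -integral_cst; last exact: mxC.
    have [_ _ fE] := fK ij.1.
    apply: (@le_trans _ _ (\int[m]_(w in x @^-1` (D ij)) (f ij.1 (x w))%:E)).
      apply: ge0_le_integral => //.
      - exact: mxC.
      - by move=> w _; rewrite lee_fin ltW.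
      - by apply: measurable_EFinS; [exact: mxC|exact: measurableT_comp].
      - by move=> w /= /DP /ltW; rewrite lee_fin.
    rewrite fE//; apply: le_measure; rewrite ?inE//; last exact: myC.
    by apply: measurableI; [exact: myC|exact: mxC].
  move=> /le_lt_trans /(_ Kn_fin).
  by rewrite -lte_pdivlMl// => /lt_le_trans; apply; exact: leey.
exists G => [|i].
- apply/seteqP; split => // v _.
  have [[n _ [k _ Dv]]|Nv] := pselect ((\bigcup_n \bigcup_k D (n, k)) v).
    by exists (pickle (Some (n, k))) => //; rewrite /G pickleK.
  by exists (pickle (None : option (nat * nat))) => //; rewrite /G pickleK.
- rewrite /G; case: unpickle => [[ij|]|]; split => //.
  + exact: mDlty.
  + by rewrite /pushforward mN0 ltry.
  + by rewrite /pushforward preimage_set0 measure0 ltry.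
Qed.

End sigma_finite_cond_prob.

Section path_space_sub_sigma.
Variables (R : realType) (X : ptopologicalType) (k : path_class).
Local Notation Omega := (path_space R X k).

(** Whole paths with the smaller sigma-field of the coordinates in [I]. The past and the future thus
    become the identity map into two measurable types, without restricting paths to subintervals,
    and the events [past t] and [future t] are their measurable sets. *)
Definition observed (I : set (time R)) := g_sigma_algebraType (@cylinders R X k I).

Definition observe (I : set (time R)) (w : Omega) : observed I := w.

Lemma measurable_coord (I : set (time R)) (t : time R) : I t ->
  measurable_fun setT (@Defs.coord R X k t : observed I -> borel X).
Proof. by move=> It _ A mA; apply: sub_sigma_algebra; exists t => //; exists A. Qed.

Lemma measurable_observe (I : set (time R)) : measurable_fun setT (observe I).
Proof.
move=> _ A mA; rewrite setTI.
by apply: sub_sigma_algebra2 mA => B [t It tB]; exists t.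
Qed.

Lemma measurable_canonical_process (t : time R) :
  measurable_fun setT (@canonical_process R X k t).
Proof. exact: (@measurable_coord setT t I). Qed.

End path_space_sub_sigma.

Section markov.
Variables (R : realType) (X : ptopologicalType) (k : path_class).
Local Notation Omega := (path_space R X k).
Local Open Scope ereal_scope.

(** [is_markov] grants sigma-finiteness at one time [t0] only, while the density [e] is needed at
    every [t]. As [t0] lies before or after [t], the events of X at time [t0] belong to the past or
    the future of [t] and have conditional probabilities given the present. *)
Lemma markov_sigma_finite (Q : {measure set Omega -> \bar R}) (t : time R) :
  is_markov Q -> sigma_finite setT (pushforward Q (canonical_process t)).
Proof.
move=> [[t0 Qt0] Qmarkov].
apply: (sigma_finite_cond_prob _ _ Qt0) => [||C mC];
  [exact: measurable_canonical_process..|].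
have [t0t|tt0] := leP (\val t0) (\val t).
  have [||f [g [h [fC _ _ _]]]] := Qmarkov t (canonical_process t0 @^-1` C) setT.
  - apply: sub_sigma_algebra; exists t0 => //; exists C => //.
    by rewrite setTI.
  - exact: (@measurableT _ (observed X k [set u | (\val t <= \val u)%R])).
  - by exists f.
have [||f [g [h [_ gC _ _]]]] := Qmarkov t setT (canonical_process t0 @^-1` C).
- exact: (@measurableT _ (observed X k [set u | (\val u <= \val t)%R])).
- apply: sub_sigma_algebra; exists t0; first exact: ltW.
  by exists C => //; rewrite setTI.
- by exists g.
Qed.

Lemma markov_cond_indep (Q : {measure set Omega -> \bar R}) (t : time R) :
  is_markov Q -> cond_indep Q (observe [set u | (\val u <= \val t)%R])
    (observe [set u | (\val t <= \val u)%R]) (canonical_process t).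
Proof.
move=> [_ Qmarkov] A B mA mB.
have [f [g [h [fA gB [mh h01 hAB] hfg]]]] := Qmarkov t A B mA mB.
exists f, g; split => //.
have [mf f01 _] := fA; have [mg g01 _] := gB.
have mX := @measurable_canonical_process R X k t.
apply: etrans (_ : \int[Q]_w (h (canonical_process t w))%:E = _).
  apply: ge0_ae_eq_integral => //.
  - by apply/measurable_EFinP; apply: measurable_funM; exact: measurableT_comp.
  - by apply/measurable_EFinP; exact: measurableT_comp.
  - move=> w _; rewrite lee_fin mulr_ge0//.
      by have /andP[] := f01 (canonical_process t w).
    by have /andP[] := g01 (canonical_process t w).
  - by move=> w _; rewrite lee_fin; have /andP[] := h01 (canonical_process t w).
  - by apply: filterS hfg => w ->.
by have := hAB _ measurableT; rewrite preimage_setT setIT.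
Qed.

End markov.

Theorem proposition2p10 (R : realType) (X : ptopologicalType)
    (X_polish : polish R X) (k : path_class)
    (Q : {sigma_finite_measure set (path_space R X k) -> \bar R})
    (Q_neq0 : (Q setT != 0)%E) (Q_markov : is_markov Q)
    (mu0 mu1 : probability (borel X) R)
    (P : probability (path_space R X k) R)
    (P_solution : schrodinger_solution Q mu0 mu1 P) :
  is_markov P.
Proof.
have [P_feasible P_fin P_min] := P_solution.
have P_lty : (P setT < +oo)%E by rewrite probability_setT ltry.
split; first by exists (time0 R); exact: sigma_finite_pushforward.
move=> t A B mA mB.
(* Both index sets contain [t] itself, so the present is a function of the past and of the future,
   by the identity on paths. *)
have [|f [g [Af Bg ABfg]]] := entropy_minimizer_cond_indep
  (@measurable_observe R X k [set u | \val u <= \val t])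
  (@measurable_observe R X k [set u | \val t <= \val u])
  (@measurable_coord R X k [set u | \val u <= \val t] t (lexx _))
  (@measurable_coord R X k [set u | \val t <= \val u] t (lexx _))
  (fun=> erefl) (fun=> erefl) (markov_sigma_finite t Q_markov)
  (@markov_cond_indep R X k Q t Q_markov) P_fin _ mA mB.
(* Equal laws of the past and of the future entail equal endpoint marginals, so every such
   competitor is feasible. *)
- move=> P' P'past P'future; apply: P_min => C mC.
  have [P0 P1] := P_feasible C mC; rewrite -P0 -P1.
  have t0 : \val (time0 R) <= \val t.
    by have := valP t; rewrite inE /= in_itv => /andP[].
  have t1 : \val t <= \val (time1 R).
    by have := valP t; rewrite inE /= in_itv => /andP[].
  split.
    apply: (P'past (canonical_process (time0 R) @^-1` C)).
    apply: sub_sigma_algebra; exists (time0 R) => //.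
    by exists C => //; rewrite setTI.
  apply: (P'future (canonical_process (time1 R) @^-1` C)).
  apply: sub_sigma_algebra; exists (time1 R) => //.
  by exists C => //; rewrite setTI.
exists f, g, (fun y => f y * g y); split => //.
exact: nearW.
Qed.
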